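(* Let $\mathcal{H}$ be a finite-dimensional complex Hilbert space with $\dim\mathcal{H}\geq 2$, and let $\Phi:\mathcal{B}(\mathcal{H})\to\mathcal{B}(\mathcal{H})$ be a bijective linear map. The following are equivalent: (i) For all $T,S\in\mathcal{B}(\mathcal{H})$, $\Phi(T)\sim_u\Phi(S)$ whenever $T\sim_u S$. (ii) For all $T,S\in\mathcal{B}(\mathcal{H})$, $w(\Phi(T))=w(\Phi(S))$ whenever $T\sim_u S$. (iii) There exist a unitary operator $W\in\mathcal{B}(\mathcal{H})$ and scalars $c,\alpha\in\mathbb{C}$, with $c\neq 0$, such that either $$\Phi(X)=cWXW^*+\alpha\,\mathrm{Tr}(X)I_{\mathcal{H}}\qquad\text{for every }X\in\mathcal{B}(\mathcal{H}),$$ or $$\Phi(X)=cWX^{\mathrm{t}}W^*+\alpha\,\mathrm{Tr}(X)I_{\mathcal{H}}\qquad\text{for every }X\in\mathcal{B}(\mathcal{H}).$$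
   Context: $\mathcal{B}(\mathcal{H})$ is the algebra of all bounded linear operators on $\mathcal{H}$ and $I_{\mathcal{H}}$ is the identity operator. $T\sim_u S$ (unitarily similar) means $T=WSW^*$ for some unitary $W\in\mathcal{B}(\mathcal{H})$. The numerical radius is $w(T)=\sup\{|\langle Tx,x\rangle|:\|x\|=1\}$. $\mathrm{Tr}$ is the usual trace, and $X^{\mathrm{t}}$ is the transpose of $X$ with respect to a fixed orthonormal basis $(e_i)$ of $\mathcal{H}$, i.e. $\langle X^{\mathrm{t}}e_j,e_i\rangle=\langle Xe_i,e_j\rangle$ for all $i,j$. *)

(* Defs.v *)
From HB Require Import structures.
From mathcomp Require Import all_boot all_order all_algebra.
From mathcomp Require Import sesquilinear complex.
From mathcomp Require Import boolp classical_sets reals.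
Set Implicit Arguments.
Unset Strict Implicit.
Unset Printing Implicit Defensive.
Import Order.TTheory GRing.Theory Num.Theory passmx.
Local Open Scope ring_scope.
Local Open Scope classical_set_scope.

(* A finite-dimensional complex Hilbert space is a [vectType] over [R[i]], with *)
(* [R] the real numbers, together with a positive definite Hermitian form that  *)
(* is linear in its first argument; completeness, and the boundedness of the    *)
(* elements of ['End(H)], are automatic.                                        *)

Section HilbertSpace.
Context {R : realType} {H : vectType R[i]} (dotp : {dot H for Num.conj}).
Implicit Types (T S W X : 'End(H)) (x y : H).

Definition hnorm x : R := Num.sqrt (complex.Re (dotp x x)).

Definition is_adjoint T S := forall x y, dotp (T x) y = dotp x (S y).

(* The value 0 that [xget] returns when there is no adjoint is never used: see  *)
(* [adjointP].                                                                  *)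
Definition adjoint T : 'End(H) := xget 0 [set S | is_adjoint T S].

Definition unitary W :=
  (W \o adjoint W)%VF = \1%VF /\ (adjoint W \o W)%VF = \1%VF.

Definition unitarily_similar T S :=
  exists2 W, unitary W & T = (W \o S \o adjoint W)%VF.

(* When [H] is not 0 the set is nonempty, and by compactness it is bounded, so  *)
(* the default value of [sup] is never used.                                    *)
Definition numradius T : R :=
  sup [set Normc.normc (dotp (T x) x) | x in [set x | hnorm x = 1]].

Definition orthonormal_basis (e : (\dim {:H}).-tuple H) :=
  basis_of {:H} e && orthonormal dotp e.

End HilbertSpace.

(* [mxof] acts on row vectors, so it gives the transpose of the usual matrix;   *)
(* [lftransposeP] and [lftraceE] below express both notions with [dotp].        *)
Definition lftrace (F : fieldType) (V : vectType F) (X : 'End(V)) : F :=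
  \tr (mxof (vbasis {:V}) (vbasis {:V}) X).

Definition lftranspose (F : fieldType) (V : vectType F)
    (e : (\dim {:V}).-tuple V) (X : 'End(V)) : 'End(V) :=
  hommx e e (mxof e e X)^T.

Section Facts.
Context {R : realType} {H : vectType R[i]} (dotp : {dot H for Num.conj}).
Variables (e : (\dim {:H}).-tuple H) (he : orthonormal_basis dotp e).
Implicit Types (T X : 'End(H)) (x y : H).

Lemma dotpC x y : dotp x y = Num.conj (dotp y x).
Proof. by rewrite [LHS]hermC expr0 mul1r. Qed.

Lemma dotp_suml n (c : 'I_n -> R[i]) (v : 'I_n -> H) y :
  dotp (\sum_i c i *: v i) y = \sum_i c i * dotp (v i) y.
Proof.
by rewrite [LHS]linear_sumlz; apply: eq_bigr => i _; exact: linearZl_LR.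
Qed.

Lemma dotp_basis i j : dotp (tnth e i) (tnth e j) = (i == j)%:R.
Proof.
have ortho_nth (s : seq H) : pair_ortho_rec dotp s ->
    forall k l, (k < l < size s)%N -> dotp s`_k s`_l = 0.
  elim: s => [|v s IHs] /=; first by move=> _ k l; rewrite ltn0 andbF.
  rewrite andbT => /andP[/allP vs os] [|k] [|l] //=; rewrite !ltnS => kl.
    by apply/eqP/vs/mem_nth.
  exact: IHs.
case/andP: he => _ /andP[/allP e1 oe].
have [<-|neq_ij] := eqVneq i j.
  by apply/eqP/e1/mem_tnth.
rewrite !(tnth_nth 0); case: (ltngtP i j) => [lt_ij|lt_ji|/val_inj eq_ij].
- by apply: ortho_nth => //; rewrite lt_ij size_tuple /=.
- by rewrite dotpC ortho_nth ?rmorph0// lt_ji size_tuple /=.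
- by rewrite eq_ij eqxx in neq_ij.
Qed.

Lemma coord_dotp x i : coord e i x = dotp x (tnth e i).
Proof.
have [be _] := andP he.
rewrite [in RHS](coord_basis be (memvf x)) dotp_suml (bigD1 i)//= -(tnth_nth 0).
rewrite dotp_basis eqxx mulr1 big1 ?addr0// => j neq_ji.
by rewrite -(tnth_nth 0) dotp_basis (negPf neq_ji) mulr0.
Qed.

Lemma basis_expand x : x = \sum_i dotp x (tnth e i) *: tnth e i.
Proof.
have [be _] := andP he; rewrite [LHS](coord_basis be (memvf x)).
by apply: eq_bigr => i _; rewrite coord_dotp -(tnth_nth 0).
Qed.

Lemma is_adjoint_uniq T S S' :
  is_adjoint dotp T S -> is_adjoint dotp T S' -> S = S'.
Proof.
move=> TS TS'; apply/lfunP => y; rewrite [LHS]basis_expand [RHS]basis_expand.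
apply: eq_bigr => i _; congr (_ *: _).
by rewrite dotpC -TS TS' -dotpC.
Qed.

Lemma adjointP T : is_adjoint dotp T (adjoint dotp T).
Proof.
apply: (@xgetPex _ 0 [set S | is_adjoint dotp T S]).
pose g y := \sum_i dotp y (T (tnth e i)) *: tnth e i.
have g_lin : linear g.
  move=> a u v; rewrite /g scaler_sumr -big_split; apply: eq_bigr => i _ /=.
  by rewrite linearPl scalerDl scalerA.
pose gl : {linear H -> H} := HB.pack g (GRing.isLinear.Build _ _ _ _ g g_lin).
exists (linfun gl) => x y; rewrite lfunE /= /g.
rewrite [in LHS](basis_expand x) linear_sum.
under eq_bigr do rewrite linearZ.
rewrite dotp_suml dotpC dotp_suml rmorph_sum; apply: eq_bigr => i _.
by rewrite rmorphM/= -!dotpC mulrC.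
Qed.

Lemma mxof_basisE X i j : mxof e e X i j = dotp (X (tnth e i)) (tnth e j).
Proof.
by rewrite mxE /= vecof_delta mxE -(tnth_nth 0) coord_dotp.
Qed.

Lemma lftransposeP X i j :
  dotp (lftranspose e X (tnth e j)) (tnth e i) = dotp (X (tnth e i)) (tnth e j).
Proof.
have [be _] := andP he.
by rewrite -!mxof_basisE hommxK// mxE.
Qed.

Lemma lftraceE X : lftrace X = \sum_i dotp (X (tnth e i)) (tnth e i).
Proof.
have [be _] := andP he; have bb := vbasisP {:H}.
under eq_bigr do rewrite -mxof_basisE; rewrite -/(mxtrace _).
rewrite /lftrace -[X in mxof _ _ X]comp_lfun1r -[X in mxof _ _ X]comp_lfun1l.
rewrite (mxof_comp _ _ be) (mxof_comp _ _ be) mxtrace_mulC mulmxA.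
by rewrite -mxof_comp// comp_lfun1l mxof1 ?(basis_free be)// mul1mx.
Qed.

End Facts.

(* Main.v *)
(* Fix an orthonormal basis and write [phi] for the matrix form of [Phi].  For
   a unitary [U], the map [Z |-> phi (U (phi^-1 Z) U^* )] and its inverse do not
   increase the numerical radius.  Every matrix [x x^*] with [x] a unit vector is
   an exposed point of the polar of the numerical radius ball, so the dual of
   this map permutes, up to a phase, the rank one projections; it is therefore
   a phase times an automorphism or antiautomorphism [Z |-> V Z V^*] or
   [Z |-> V Z^T V^*].  Comparing traces of operators on the matrix algebra shows
   that [phi^-1 1] is scalar, that all phases are 1, and that conjugation by the
   reflection in [x] is transported to conjugation by the reflection in some [y].
   Then [phi^-1 (y y^* )] commutes with every reflection commuting with [x x^*],
   hence is a combination of [x x^*] and 1.  By transitivity of the unitary group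
   a combination of [phi] and of [X |-> (tr X) 1] maps rank one projections to
   rank one projections, and such maps are classified. *)

Require Import Defs.
From HB Require Import structures.
From mathcomp Require Import all_boot all_order all_algebra.
From mathcomp Require Import sesquilinear spectral complex.
From mathcomp Require Import boolp classical_sets reals.
From mathcomp Require Import topology normedtype derive.
From mathcomp Require Import ring.
Set Implicit Arguments.
Unset Strict Implicit.
Unset Printing Implicit Defensive.
Import Order.TTheory GRing.Theory Num.Theory numFieldNormedType.Exports passmx.
Local Open Scope ring_scope.

(** * Hermitian adjoints and outer products *)

Section Adjoint.
Local Open Scope sesquilinear_scope.
Context {C : numClosedFieldType}.

(** Hypothesis (ii) never compares w(Phi(T)) with w(T), so [phi] cannot itself be treated as an
    isometry; only the conjugations transported by [phi] can. They form a representation of the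
    unitary group, but each is known only up to a phase and a transposition. Transposition
    disappears on squares, so each unitary for which it must be excluded gets an explicit square
    root among the pseudoreflections. The phase is tested by the operator trace: c |tr V|^2 = |tr
    U|^2 with |c| = 1 forces c = 1 once tr U is nonzero. For the reflection with eigenvalue -1 this
    trace is n - 2, which vanishes when n = 2; hence the eigenvalue i, of trace n - 1 + i, comes
    first. It shows that [psi 1] is scalar, after which every twist fixes the identity and every
    phase is 1. For a general unitary the transposition stays undecided, which is harmless: both
    alternatives preserve products A B A and rank one projections. In the matrix argument, the real
    numbers enter only to attain the maximum of the modulus of a quadratic form on the unit
    sphere. *)

Lemma adjmxM m n p (A : 'M[C]_(m, n)) (B : 'M[C]_(n, p)) :
  (A *m B)^t* = B^t* *m A^t*.
Proof. by rewrite trmx_mul map_mxM. Qed.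

Lemma adjmxD m n (A B : 'M[C]_(m, n)) : (A + B)^t* = A^t* + B^t*.
Proof. by rewrite linearD map_mxD. Qed.

Lemma adjmxB m n (A B : 'M[C]_(m, n)) : (A - B)^t* = A^t* - B^t*.
Proof. by rewrite linearB map_mxB. Qed.

Lemma adjmxZ m n (c : C) (A : 'M[C]_(m, n)) : (c *: A)^t* = c^* *: A^t*.
Proof. by rewrite linearZ/= map_mxZ. Qed.

Lemma adjmx_scalar n (c : C) : (c%:M : 'M[C]_n)^t* = (c^*)%:M.
Proof. by rewrite tr_scalar_mx map_scalar_mx. Qed.

Lemma adjmx1 n : (1%:M : 'M[C]_n)^t* = 1%:M.
Proof. by rewrite adjmx_scalar rmorph1. Qed.

Lemma adjmx0 m n : (0 : 'M[C]_(m, n))^t* = 0.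
Proof. by rewrite trmx0 map_mx0. Qed.

Lemma adjmx_delta m n i j : (delta_mx i j : 'M[C]_(m, n))^t* = delta_mx j i.
Proof. by rewrite trmx_delta map_delta_mx. Qed.

Lemma mxtrace_adj n (A : 'M[C]_n) : \tr (A^t*) = (\tr A)^*.
Proof. by rewrite trace_map_mx mxtrace_tr. Qed.

Definition dot n (x y : 'cV[C]_n) : C := (x^t* *m y) 0 0.

Lemma dotE n (x y : 'cV[C]_n) : x^t* *m y = (dot x y)%:M.
Proof. exact: mx11_scalar. Qed.

Lemma outerM n (x y u v : 'cV[C]_n) :
  (x *m y^t*) *m (u *m v^t*) = dot y u *: (x *m v^t*).
Proof.
by rewrite -mulmxA (mulmxA _ u) dotE mul_scalar_mx -scalemxAr.
Qed.

Lemma outerMv n (x y u : 'cV[C]_n) : (x *m y^t*) *m u = dot y u *: x.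
Proof. by rewrite -mulmxA dotE mul_mx_scalar. Qed.

Lemma outer_adj n (x y : 'cV[C]_n) : (x *m y^t*)^t* = y *m x^t*.
Proof. by rewrite adjmxM trmxCK. Qed.

Lemma mxtrace_outer n (x y : 'cV[C]_n) : \tr (x *m y^t*) = dot y x.
Proof. by rewrite mxtrace_mulC dotE mxtrace_scalar. Qed.

Lemma dotC n (x y : 'cV[C]_n) : dot x y = (dot y x)^*.
Proof. by rewrite -!mxtrace_outer -mxtrace_adj outer_adj. Qed.

Lemma dotEsum n (x y : 'cV[C]_n) : dot x y = \sum_i (x i 0)^* * y i 0.
Proof. by rewrite /dot mxE; apply: eq_bigr => i _; rewrite !mxE. Qed.

Lemma dot_ge0 n (x : 'cV[C]_n) : 0 <= dot x x.
Proof. by rewrite dotEsum; apply: sumr_ge0 => i _; rewrite mulrC mul_conjC_ge0. Qed.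

Lemma dot_eq0 n (x : 'cV[C]_n) : (dot x x == 0) = (x == 0).
Proof.
apply/eqP/eqP => [/eqP|->]; last by rewrite /dot mulmx0 mxE.
rewrite dotEsum psumr_eq0; last by move=> i _; rewrite mulrC mul_conjC_ge0.
move/allP => x0; apply/matrixP => i j; rewrite ord1 mxE; apply/eqP.
by have := x0 i (mem_index_enum _); rewrite /= mulrC mul_conjC_eq0.
Qed.

Lemma dotDr n (x y z : 'cV[C]_n) : dot x (y + z) = dot x y + dot x z.
Proof. by rewrite /dot mulmxDr mxE. Qed.
Lemma dotZr n (x y : 'cV[C]_n) c : dot x (c *: y) = c * dot x y.
Proof. by rewrite /dot -scalemxAr mxE. Qed.
Lemma dotDl n (x y z : 'cV[C]_n) : dot (y + z) x = dot y x + dot z x.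
Proof. by rewrite dotC dotDr rmorphD/= -!dotC. Qed.
Lemma dotZl n (x y : 'cV[C]_n) c : dot (c *: x) y = c^* * dot x y.
Proof. by rewrite dotC dotZr rmorphM/= -dotC. Qed.
Lemma dot0r n (x : 'cV[C]_n) : dot x 0 = 0.
Proof. by rewrite /dot mulmx0 mxE. Qed.

Lemma outer_eq0 n (x y : 'cV[C]_n) : x *m y^t* = 0 -> x = 0 \/ y = 0.
Proof.
move=> xy0; have [->|y0] := eqVneq y 0; [by right|left].
have := outerMv x y y; rewrite xy0 mul0mx => /esym/eqP.
by rewrite scaler_eq0 dot_eq0 (negPf y0) => /eqP.
Qed.

Lemma adj_outer_sqr n (x y : 'cV[C]_n) c :
  (x + c *: y) *m (x + c *: y)^t* =
  x *m x^t* + c *: (y *m x^t*) + c^* *: (x *m y^t*) + (c * c^*) *: (y *m y^t*).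
Proof.
rewrite adjmxD adjmxZ mulmxDl !mulmxDr -!scalemxAl -!scalemxAr scalerA.
by rewrite -!addrA; congr (_ + _); rewrite addrCA.
Qed.

(** Polarization: expanding at x + c y for c = 1 and c = i isolates the value at y x^*, and matrix
    units are of this form. *)
Lemma outer_span n (V : lmodType C) (d : {linear 'M[C]_n -> V}) :
  (forall x : 'cV_n, d (x *m x^t*) = 0) -> forall X, d X = 0.
Proof.
move=> d0.
have dxy (x y : 'cV_n) : d (y *m x^t*) = 0.
  have eqn c : c *: d (y *m x^t*) + c^* *: d (x *m y^t*) = 0.
    have := d0 (x + c *: y); rewrite adj_outer_sqr !linearD !linearZ/=.
    by rewrite !d0 scaler0 addr0 add0r.
  have := eqn 1; rewrite rmorph1 !scale1r => /addr0_eq e1.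
  have := eqn 'i; rewrite conjCi -e1 scaleNr scalerN opprK -scalerDl => /eqP.
  by rewrite scaler_eq0 -mulr2n mulrn_eq0/= (negPf (neq0Ci _)) => /eqP.
move=> X; rewrite (matrix_sum_delta X) !linear_sum big1// => i _.
rewrite linear_sum big1//= => j _; rewrite linearZ/= -(mul_delta_mx (0 : 'I_1)).
by rewrite -[delta_mx _ j]trmxCK adjmx_delta dxy scaler0.
Qed.

(** The points 1, -1, 2, -2 suffice. Even and odd combinations of the four values isolate 24 [x4],
    12 [x3] and 2 [x2]; [cancel k] divides by k + 1. *)
Lemma poly4_eq0 (x1 x2 x3 x4 : C) :
  (forall t : C, t^* = t ->
     t * x1 + t ^+ 2 * x2 + t ^+ 3 * x3 + t ^+ 4 * x4 = 0) ->
  [/\ x1 = 0, x2 = 0, x3 = 0 & x4 = 0].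
Proof.
move=> H; pose f t := t * x1 + t ^+ 2 * x2 + t ^+ 3 * x3 + t ^+ 4 * x4.
have f0 (k : nat) : f k%:R = 0 by apply: H; rewrite conjC_nat.
have fN0 (k : nat) : f (- k%:R) = 0 by apply: H; rewrite rmorphN/= conjC_nat.
have cancel k (x : C) : k.+1%:R * x = 0 -> x = 0.
  by move/eqP; rewrite mulf_eq0 pnatr_eq0 => /eqP.
have x4_0 : x4 = 0.
  apply: (cancel 23); transitivity (f 2%:R + f (- 2%:R) - 4 * (f 1%:R + f (- 1%:R))).
    by rewrite /f; ring.
  by rewrite !f0 !fN0; ring.
have x3_0 : x3 = 0.
  apply: (cancel 11); transitivity (f 2%:R - f (- 2%:R) - 2 * (f 1%:R - f (- 1%:R))).
    by rewrite /f; ring.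
  by rewrite !f0 !fN0; ring.
have x2_0 : x2 = 0.
  apply: (cancel 1); transitivity (f 1%:R + f (- 1%:R)); last by rewrite f0 fN0 addr0.
  by rewrite /f x4_0; ring.
split=> //; have := f0 1; rewrite /f x2_0 x3_0 x4_0 !mulr0 !addr0 mul1r //.
Qed.

Lemma mx_poly4_eq0 m n (X1 X2 X3 X4 : 'M[C]_(m, n)) :
  (forall t : C, t^* = t ->
     t *: X1 + t ^+ 2 *: X2 + t ^+ 3 *: X3 + t ^+ 4 *: X4 = 0) ->
  [/\ X1 = 0, X2 = 0, X3 = 0 & X4 = 0].
Proof.
move=> H; have H' i j :
    [/\ X1 i j = 0, X2 i j = 0, X3 i j = 0 & X4 i j = 0].
  apply: poly4_eq0 => t tR.
  by have /matrixP/(_ i j) := H t tR; rewrite !mxE.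
by split; apply/matrixP => i j; rewrite mxE; case: (H' i j).
Qed.

End Adjoint.

(** * Linear maps preserving rank one positive matrices *)

(** c and its conjugate are linearly independent functions: c = 1 and c = i already separate
    them. *)
Lemma conj_comb_eq0 (C : numClosedFieldType) (V : lmodType C) (u v : V) :
  (forall c : C, c *: u + c^* *: v = 0) -> u = 0.
Proof.
move=> H; have := H 1; rewrite rmorph1 !scale1r => /addr0_eq e1.
have := H 'i; rewrite conjCi -e1 scaleNr scalerN opprK -scalerDl => /eqP.
by rewrite scaler_eq0 -mulr2n mulrn_eq0/= (negPf (neq0Ci _)) => /eqP.
Qed.

(** Independence of c^2, its conjugate and |c|^2: c = 1 and c = i give d = 0 and u = -v, then c = 1
    + i, whose square is 2i, gives u = 0. *)
Lemma conj_quad_comb_eq0 (C : numClosedFieldType) (V : lmodType C) (u v d : V) :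
  (forall c : C, (c ^+ 2) *: u + (c^* ^+ 2) *: v = (c * c^*) *: d) -> u = 0.
Proof.
move=> H; have := H 1; rewrite rmorph1 !expr1n mulr1 !scale1r => uv.
have := H 'i; rewrite conjCi sqrrN sqrCi mulrN -expr2 sqrCi opprK scale1r.
rewrite !scaleN1r -opprD uv => d0.
have {}d0 : d = 0.
  by move/eqP: d0; rewrite eq_sym -addr_eq0 -mulr2n -scaler_nat scaler_eq0 pnatr_eq0 => /eqP.
have {}uv : u = - v by apply/eqP; rewrite -addr_eq0 uv d0.
have := H (1 + 'i); rewrite d0 scaler0 rmorphD/= rmorph1 conjCi.
have -> : (1 + 'i : C) ^+ 2 = 'i *+ 2 by rewrite sqrrD sqrCi; ring.
have -> : (1 - 'i : C) ^+ 2 = - 'i *+ 2 by rewrite sqrrB sqrCi; ring.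
have -> : v = - u by rewrite uv opprK.
rewrite scalerN -scaleNr mulNrn opprK -scalerDl -mulrnDr => /eqP.
by rewrite scaler_eq0 mulrn_eq0/= (negPf (neq0Ci _)) => /eqP.
Qed.

Section RankOne.
Local Open Scope sesquilinear_scope.
Context {C : numClosedFieldType} {n : nat}.

(** Allowing every [x], not only unit vectors, makes the condition applicable along the whole line e
    + t y. *)
Definition rank1_preserving (L : 'M[C]_n -> 'M[C]_n) :=
  [/\ forall X, \tr (L X) = \tr X, injective L &
      forall x : 'cV_n, exists y : 'cV_n, L (x *m x^t*) = y *m y^t*].

(** The defect between [L] and its conjugate by the adjoint is complex linear, since the two
    conjugations cancel, and it vanishes on every x x^*. *)
Lemma rank1_preserving_adj (L : {linear 'M[C]_n -> 'M[C]_n}) X :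
  rank1_preserving L -> L (X^t*) = (L X)^t*.
Proof.
case=> _ _ rkL; pose d Y := (L (Y^t*))^t* - L Y.
have lin_d : linear d.
  move=> a A B; rewrite /d adjmxD adjmxZ !(linearP L) adjmxD adjmxZ conjCK.
  by rewrite scalerBr addrACA opprD.
pose dl : {linear 'M[C]_n -> 'M[C]_n} :=
  HB.pack d (GRing.isLinear.Build _ _ _ _ d lin_d).
have d0 (x : 'cV_n) : dl (x *m x^t*) = 0.
  by rewrite -[dl _]/(d _) /d outer_adj; have [y ->] := rkL x; rewrite outer_adj subrr.
by have /eqP := outer_span d0 X; rewrite -[dl _]/(d _) subr_eq0 => /eqP <-; rewrite trmxCK.
Qed.

(** Rank one written as a polynomial identity, so that coefficients can be compared when [M] depends
    polynomially on a parameter. *)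
Lemma rank1_sandwich (f h : 'cV[C]_n) (M := h *m h^t*) :
  M *m (f *m f^t*) *m M = dot f (M *m f) *: M.
Proof. by rewrite /M outerM -scalemxAl outerM outerMv dotZr scalerA. Qed.

Lemma sandwich_expand (P B Q : 'M[C]_n) (t a k : C) : P *m P = P ->
  (P + t *: B + t ^+ 2 *: Q) *m P *m (P + t *: B + t ^+ 2 *: Q) =
    (1 + t * a + t ^+ 2 * k) *: (P + t *: B + t ^+ 2 *: Q) ->
  t *: (B *m P + P *m B - B - a *: P)
  + t ^+ 2 *: (P *m Q + Q *m P + B *m P *m B - Q - a *: B - k *: P)
  + t ^+ 3 *: (B *m P *m Q + Q *m P *m B - a *: Q - k *: B)
  + t ^+ 4 *: (Q *m P *m Q - k *: Q) = 0.
Proof.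
move=> PP; rewrite !mulmxDl !mulmxDr -!scalemxAl -!scalemxAr.
rewrite !PP -!(mulmxA _ P P) !PP.
move: (B *m P *m B) (B *m P *m Q) (Q *m P *m B) (Q *m P *m Q).
move: (B *m P) (P *m B) (P *m Q) (Q *m P) => X1 X2 X3 X4 X5 X6 X7 X8 E.
apply/matrixP => i j; move/matrixP/(_ i j)/eqP: E.
rewrite -subr_eq0 !mxE => /eqP E; rewrite -[RHS]E; ring.
Qed.

(** For real t, the image of (e + t y)(e + t y)^* is P + t B + t^2 Q and has the form h h^*. The
    sandwich identity around P then has degree 4 in t; its constant terms agree, and the
    coefficients of t, t^2, t^3, t^4 give the conclusions. *)
Lemma rank1_pencil (L : {linear 'M[C]_n -> 'M[C]_n}) (e y f : 'cV[C]_n) :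
  rank1_preserving L -> dot f f = 1 -> L (e *m e^t*) = f *m f^t* ->
  dot e y = 0 ->
  let P := f *m f^t* in let Q := L (y *m y^t*) in
  let B := L (y *m e^t*) + L (e *m y^t*) in let b := B *m f in
  let k := dot f (Q *m f) in
  [/\ B = b *m f^t* + f *m b^t*, dot f b = 0,
      Q = b *m b^t* + P *m Q + Q *m P - k *: P,
      B *m P *m Q + Q *m P *m B = k *: B & Q *m P *m Q = k *: Q].
Proof.
move=> rpL ff Pe ey P Q B b k.
have [trL _ rkL] := rpL.
have PP : P *m P = P by rewrite /P outerM ff scale1r.
pose a := dot f b.
have adjB : B^t* = B.
  by rewrite /B adjmxD -!(rank1_preserving_adj _ rpL) !outer_adj addrC.
have trB : \tr B = 0.
  by rewrite /B mxtraceD !trL !mxtrace_outer ey dotC ey rmorph0 addr0.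
have trP : \tr P = 1 by rewrite /P mxtrace_outer.
have pencil t : t^* = t ->
    t *: (B *m P + P *m B - B - a *: P)
    + t ^+ 2 *: (P *m Q + Q *m P + B *m P *m B - Q - a *: B - k *: P)
    + t ^+ 3 *: (B *m P *m Q + Q *m P *m B - a *: Q - k *: B)
    + t ^+ 4 *: (Q *m P *m Q - k *: Q) = 0.
  move=> tR; pose M : 'M[C]_n := P + t *: B + t ^+ 2 *: Q.
  have [h Mh] : exists h : 'cV_n, M = h *m h^t*.
    have [h Lh] := rkL (e + t *: y); exists h; rewrite -Lh adj_outer_sqr tR.
    by rewrite !linearD !linearZ/= Pe -/P -/Q /M /B scalerDr expr2 !addrA.
  have fMf : dot f (M *m f) = 1 + t * a + t ^+ 2 * k.
    rewrite /M !mulmxDl !dotDr -!scalemxAl !dotZr -/b -/a -/k.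
    by rewrite /P outerMv ff scale1r ff.
  have := rank1_sandwich f h; cbv zeta; rewrite -Mh -/P fMf /M.
  exact: sandwich_expand.
have [E1 E2 E3 E4] := mx_poly4_eq0 pencil.
(* The trace of the coefficient of t reads 2a = a, because B has trace 0 by orthogonality of e and
   y. *)
have a0 : a = 0.
  have : \tr (B *m P + P *m B) = \tr (B + a *: P).
    by congr mxtrace; apply/eqP; rewrite -subr_eq0 opprD addrA E1.
  rewrite [LHS]mxtraceD [RHS]mxtraceD mxtraceZ trB trP add0r mulr1 (mxtrace_mulC P).
  have -> : \tr (B *m P) = a by rewrite mulmxA mxtrace_outer.
  by move/eqP; rewrite -subr_eq0 addrK => /eqP.
have BP : B *m P = b *m f^t* by rewrite /P mulmxA.
have PB : P *m B = f *m b^t*.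
  by rewrite /b adjmxM adjB /P -mulmxA.
split.
- by move/eqP: E1; rewrite a0 scale0r subr0 subr_eq0 BP PB => /eqP.
- exact: a0.
- have -> : b *m b^t* = B *m P *m B by rewrite /b adjmxM adjB /P !mulmxA.
  move/eqP: E2; rewrite a0 scale0r subr0.
  rewrite -addrA -opprD subr_eq0 => /eqP E2.
  by apply/eqP; rewrite eq_sym subr_eq -addrA addrC E2.
- by move/eqP: E3; rewrite a0 scale0r subr0 subr_eq0 => /eqP.
- by move/eqP: E4; rewrite subr_eq0 => /eqP.
Qed.


(** The pencil for c y, with c an arbitrary complex number, splits into its parts in c, its
    conjugate, and c^2. The c^2 part is the last equality: one of A f and A^* f vanishes, the germ
    of the alternative between X and its transpose. *)
Lemma rank1_pencil_ortho (L : {linear 'M[C]_n -> 'M[C]_n}) (e y f : 'cV[C]_n) :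
  rank1_preserving L -> dot f f = 1 -> L (e *m e^t*) = f *m f^t* ->
  dot e y = 0 ->
  let A := L (y *m e^t*) in
  [/\ A = A *m f *m f^t* + f *m (A^t* *m f)^t*, dot f (A *m f) = 0 &
      A *m f *m (A^t* *m f)^t* = 0].
Proof.
move=> rpL ff Pe ey A.
have adjA : L (e *m y^t*) = A^t*.
  by rewrite /A -(rank1_preserving_adj _ rpL) outer_adj.
pose b := A *m f; pose a := A^t* *m f; pose Q := L (y *m y^t*).
(* The third conclusion of the pencil solved for b b^*; replacing y by c y multiplies it by
   |c|^2. *)
pose G := Q - f *m f^t* *m Q - Q *m (f *m f^t*) + dot f (Q *m f) *: (f *m f^t*).
have pencil c : [/\ c *: A + c^* *: A^t* =
      (c *: b + c^* *: a) *m f^t* + f *m (c *: b + c^* *: a)^t*,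
      dot f (c *: b + c^* *: a) = 0 &
      (c *: b + c^* *: a) *m (c *: b + c^* *: a)^t* = (c * c^*) *: G].
  have ecy : dot e (c *: y) = 0 by rewrite dotZr ey mulr0.
  have [] := rank1_pencil rpL ff Pe ecy.
  rewrite adjmxZ -!scalemxAl -!scalemxAr !scalerA !linearZ/= adjA -/A -/Q.
  have -> : (c *: A + c^* *: A^t*) *m f = c *: b + c^* *: a.
    by rewrite mulmxDl -!scalemxAl.
  rewrite scalerN -!scalemxAl !dotZr => E1 E2 E3 _ _; split => //.
  rewrite /G scalerDr !scalerBr scalerA [X in _ = X - _ - _ + _]E3.
  move: (_ *m (c *: b + c^* *: a)^t*) => X1.
  move: (_ *: (_ *m Q)) (_ *: (Q *m _)) (_ *: (f *m _)) => X2 X3 X4.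
  by apply/matrixP => i j; rewrite !mxE; ring.
split.
- apply/eqP; rewrite -subr_eq0; apply/eqP.
  apply: (@conj_comb_eq0 _ _ _ (A^t* - (a *m f^t* + f *m b^t*))) => c.
  have [/eqP + _ _] := pencil c; rewrite -subr_eq0 => /eqP <-.
  rewrite adjmxD !adjmxZ conjCK !mulmxDl !mulmxDr -!scalemxAl -!scalemxAr -/a -/b.
  rewrite !scalerBr !scalerDr.
  move: (_ *m _) (_ *m _) (_ *m _) (_ *m _) => X1 X2 X3 X4.
  by apply/matrixP => i j; rewrite !mxE; ring.
- apply: (@conj_comb_eq0 _ C^o _ (dot f a)) => c; have [_ + _] := pencil c.
  by rewrite dotDr !dotZr.
pose D := G - b *m b^t* - a *m a^t*.
have ba c : (c ^+ 2) *: (b *m a^t*) + (c^* ^+ 2) *: (a *m b^t*) = (c * c^*) *: D.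
  have [_ _ E] := pencil c; rewrite /D !scalerBr -E.
  rewrite adjmxD !adjmxZ conjCK !mulmxDl !mulmxDr -!scalemxAl -!scalemxAr.
  move: (_ *m _) (_ *m _) (_ *m _) (_ *m _) => X1 X2 X3 X4.
  by apply/matrixP => i j; rewrite !mxE; ring.
exact: conj_quad_comb_eq0 ba.
Qed.


(** The last hypothesis selects the alternative without transposition. The formula is then checked
    on e e^*, y e^*, e y^* and y y^* with y orthogonal to e, which together give every x x^*. *)
Lemma rank1_preserving_congr (L : {linear 'M[C]_n -> 'M[C]_n}) (e f : 'cV[C]_n) :
  rank1_preserving L -> dot e e = 1 -> dot f f = 1 ->
  L (e *m e^t*) = f *m f^t* ->
  (forall y, dot e y = 0 -> (L (y *m e^t*))^t* *m f = 0) ->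
  exists V : 'M[C]_n, forall X, L X = V *m X *m V^t*.
Proof.
move=> rpL ee ff Pe H0; have [_ injL _] := rpL.
(* Forced by the answer: if L X = V X V^* and V e = f, then applying the image of v e^* to the unit
   vector f returns V v. *)
pose V : 'M[C]_n := \matrix_(i, j) (L (delta_mx j 0 *m e^t*) *m f) i 0.
have VE v : V *m v = L (v *m e^t*) *m f.
  rewrite {2}[v]matrix_sum_delta !mulmx_suml linear_sum mulmx_suml.
  apply/matrixP => i j; rewrite mxE summxE; apply: eq_bigr => k _.
  rewrite big_ord1 -scalemxAl linearZ/= -scalemxAl !mxE (ord1 j) mulrC.
  by congr (_ * _); apply: eq_bigr => l _; rewrite (ord1 j).
have Ve : V *m e = f by rewrite VE Pe outerMv ff scale1r.
have LyE y : dot e y = 0 -> L (y *m e^t*) = (V *m y) *m f^t*.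
  move=> ey; have [-> _ _] := rank1_pencil_ortho rpL ff Pe ey.
  by rewrite H0// adjmx0 mulmx0 addr0 VE.
(* The pencil will give Q = b b^* + k P, so the point is k = 0. The cubic relation [APQ] makes f an
   eigenvector of Q for k; then Q P Q = k Q leaves k b b^* = 0. If b = 0, injectivity of [L] gives y
   = 0. *)
have Lyy y : dot e y = 0 -> L (y *m y^t*) = (V *m y) *m (V *m y)^t*.
  move=> ey; pose A := L (y *m e^t*); pose b := V *m y; pose Q := L (y *m y^t*).
  pose P := f *m f^t*; pose k := dot f (Q *m f).
  have adjA : L (e *m y^t*) = A^t*.
    by rewrite /A -(rank1_preserving_adj _ rpL) outer_adj.
  have adjQ : Q^t* = Q by rewrite /Q -(rank1_preserving_adj _ rpL) outer_adj.
  have kR : k^* = k.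
    by rewrite /k -dotC /dot adjmxM adjQ mulmxA.
  have fb : dot f b = 0.
    by rewrite /b VE; have [] := rank1_pencil_ortho rpL ff Pe ey.
  have AE : A = b *m f^t* by rewrite /A LyE.
  have APQ : A *m P *m Q + Q *m P *m A - k *: A = 0.
    apply: (@conj_comb_eq0 _ _ _ (A^t* *m P *m Q + Q *m P *m A^t* - k *: A^t*)).
    move=> c; have [c0|c0] := eqVneq (c * c^*) 0.
      by move/eqP: c0; rewrite mul_conjC_eq0 => /eqP ->; rewrite rmorph0 !scale0r addr0.
    have ecy : dot e (c *: y) = 0 by rewrite dotZr ey mulr0.
    have [_ _ _ + _] := rank1_pencil rpL ff Pe ecy.
    rewrite adjmxZ -!scalemxAl -!scalemxAr !scalerA !linearZ/= adjA -/A -/Q -/P.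
    rewrite -!scalemxAl dotZr -/k -scalerDr -[X in _ = X -> _]scalerA => /(scalerI c0) /eqP.
    rewrite -subr_eq0 => /eqP <-.
    rewrite !scalerN !mulmxDl !mulmxDr -!scalemxAl -!scalemxAr.
    move: (_ *m Q) (_ *m Q) (_ *m A) (_ *m A^t*) => X1 X2 X3 X4.
    move: (A) (A^t*) => X5 X6.
    by apply/matrixP => i j; rewrite !mxE; ring.
  have [b0|b0] := eqVneq b 0.
    have y0 : y = 0.
      have /injL : L (y *m e^t*) = L 0 by rewrite linear0 -/A AE b0 mul0mx.
      by move/outer_eq0 => [//|e0]; move: ee; rewrite e0 dot0r => /eqP; rewrite eq_sym oner_eq0.
    by rewrite y0 mulmx0 !mul0mx linear0.
  have Qf : Q *m f = k *: f.
    have : b *m (Q *m f - k *: f)^t* = 0.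
      rewrite -[RHS]APQ AE /P outerM ff scale1r -(mulmxA Q) outerM fb scale0r mulmx0 addr0.
      by rewrite adjmxB adjmxM adjmxZ adjQ kR mulmxBr -scalemxAr mulmxA.
    by case/outer_eq0 => [/eqP|/eqP]; [rewrite (negPf b0)|rewrite subr_eq0 => /eqP].
  have QP : Q *m P = k *: P by rewrite /P mulmxA Qf scalemxAl.
  have PQ : P *m Q = k *: P.
    by rewrite -[LHS]trmxCK adjmxM adjQ outer_adj QP adjmxZ outer_adj kR.
  have Bf : (L (y *m e^t*) + L (e *m y^t*)) *m f = b.
    by rewrite mulmxDl adjA H0// addr0 -/A AE outerMv ff scale1r.
  have [_ _ + _ +] := rank1_pencil rpL ff Pe ey.
  rewrite Bf -/P -/Q -/k QP PQ addrK -scalemxAl PQ => QE.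
  rewrite [in RHS]QE scalerDr => /eqP; rewrite -subr_eq0 opprD addrA addrAC subrr add0r oppr_eq0.
  rewrite scaler_eq0 => /orP[/eqP k0|/eqP /outer_eq0 [] /eqP]; last 2 first.
  - by rewrite (negPf b0).
  - by rewrite (negPf b0).
  by rewrite -/Q -/b QE k0 scale0r addr0.
exists V.
pose d X := L X - V *m X *m V^t*.
have lin_d : linear d.
  move=> a A B; rewrite /d !(linearP L) mulmxDr mulmxDl -scalemxAr -scalemxAl.
  by rewrite scalerBr addrACA opprD.
pose dl : {linear 'M[C]_n -> 'M[C]_n} :=
  HB.pack d (GRing.isLinear.Build _ _ _ _ d lin_d).
suff d0 (x : 'cV_n) : dl (x *m x^t*) = 0.
  by move=> X; apply/eqP; rewrite -subr_eq0 -[X in X == _]/(dl X) outer_span.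
rewrite -[dl _]/(d _) /d; apply/eqP; rewrite subr_eq0; apply/eqP.
have [y [c [ey ->]]] : exists y c, dot e y = 0 /\ x = y + c *: e.
  exists (x - dot e x *: e), (dot e x).
  by split; [rewrite dotDr -scaleNr dotZr ee mulr1 subrr|rewrite subrK].
rewrite mulmxA -[RHS]mulmxA -adjmxM mulmxDr -scalemxAr Ve !adj_outer_sqr.
rewrite !linearD !linearZ/= Pe Lyy// LyE// -(outer_adj y e).
by rewrite (rank1_preserving_adj _ rpL) LyE// outer_adj.
Qed.

Lemma mxtrace_delta (A : 'M[C]_n) i j : \tr (A *m delta_mx i j) = A j i.
Proof.
rewrite -(mul_delta_mx (0 : 'I_1)) mulmxA mxtrace_mulC mulmxA -rowE -colE.
by rewrite /mxtrace big_ord1 !mxE.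
Qed.

Lemma tr_outer (x y : 'cV[C]_n) :
  (x *m y^t*)^T = map_mx Num.conj y *m (map_mx Num.conj x)^t*.
Proof.
rewrite trmx_mul; congr (_ *m _); first by rewrite map_trmx trmxK.
by apply/matrixP => i j; rewrite !mxE conjCK.
Qed.

Lemma mxtrace_mul_inj (A B : 'M[C]_n) :
  (forall X, \tr (A *m X) = \tr (B *m X)) -> A = B.
Proof. by move=> H; apply/matrixP => i j; rewrite -!mxtrace_delta H. Qed.

(** Unitarity of V comes for free: preserving the trace of every X forces V^* V = 1. The alternative
    known for each single y must be made uniform in y. *)
Lemma rank1_preservingP (L : {linear 'M[C]_n -> 'M[C]_n}) :
  (0 < n)%N -> rank1_preserving L ->
  exists2 V : 'M[C]_n, V \is unitarymx &
    (forall X, L X = V *m X *m V^t*) \/ (forall X, L X = V *m X^T *m V^t*).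
Proof.
move=> n_gt0 rpL; have [trL injL rkL] := rpL.
suff [V LV] : exists V : 'M[C]_n,
    (forall X, L X = V *m X *m V^t*) \/ (forall X, L X = V *m X^T *m V^t*).
  exists V => //; rewrite -trmxC_unitary; apply/unitarymxP; rewrite trmxCK.
  apply: mxtrace_mul_inj => X; rewrite mul1mx -mulmxA mxtrace_mulC.
  case: LV => LV; first by rewrite -LV trL.
  by rewrite -{1}(trmxK X) -LV trL mxtrace_tr.
pose e : 'cV[C]_n := delta_mx (Ordinal n_gt0) 0.
have ee : dot e e = 1 by rewrite /dot adjmx_delta mul_delta_mx mxE !eqxx.
have eR : map_mx Num.conj e = e by rewrite map_delta_mx.
have [f Pe] := rkL e.
have ff : dot f f = 1 by rewrite -mxtrace_outer -Pe trL mxtrace_outer.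
have [H0|] := pselect (forall y, dot e y = 0 -> (L (y *m e^t*))^t* *m f = 0).
  by have [V LV] := rank1_preserving_congr rpL ee ff Pe H0; exists V; left.
move=> /existsNP[y1 /not_implyP[ey1 /eqP a1]].
(* A space is not the union of two proper subspaces: if y escaped one alternative while [y1] escapes
   the other, y + [y1] would satisfy neither. *)
have H0 y : dot e y = 0 -> L (y *m e^t*) *m f = 0.
  move=> ey; apply/eqP/negPn/negP => b0.
  have ab z : dot e z = 0 ->
      L (z *m e^t*) *m f = 0 \/ (L (z *m e^t*))^t* *m f = 0.
    move=> ez; apply: outer_eq0.
    by have [_ _] := rank1_pencil_ortho rpL ff Pe ez.
  have [/eqP|a0] := ab _ ey; first by rewrite (negPf b0).
  have [b1|/eqP] := ab _ ey1; last by rewrite (negPf a1).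
  have [|/eqP|/eqP] := ab (y + y1); first by rewrite dotDr ey ey1 addr0.
    by rewrite mulmxDl linearD mulmxDl b1 addr0 (negPf b0).
  by rewrite mulmxDl linearD adjmxD mulmxDl a0 add0r (negPf a1).
(* Precomposing with the transpose exchanges the two alternatives. The vector e has real entries, so
   e e^* is fixed and y e^* becomes e times the adjoint of the conjugate of y. *)
pose L' : {linear 'M[C]_n -> 'M[C]_n} := L \o trmx.
have rpL' : rank1_preserving L'.
  split=> [X|X Y /injL /trmx_inj //|x]; first by rewrite /= trL mxtrace_tr.
  have [z Lz] := rkL (map_mx Num.conj x); exists z.
  by rewrite -Lz /= tr_outer.
have Pe' : L' (e *m e^t*) = f *m f^t* by rewrite -Pe /= tr_outer eR.
have H0' y : dot e y = 0 -> (L' (y *m e^t*))^t* *m f = 0.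
  move=> ey; rewrite -(rank1_preserving_adj _ rpL') outer_adj /= tr_outer eR.
  apply: H0; transitivity ((dot e y)^*); last by rewrite ey rmorph0.
  rewrite !dotEsum rmorph_sum; apply: eq_bigr => i _.
  by rewrite rmorphM/= !mxE !conjC_nat.
have [V LV] := rank1_preserving_congr rpL' ee ff Pe' H0'.
by exists V; right => X; rewrite -LV /= trmxK.
Qed.

End RankOne.

(** * The numerical radius and its dual ball *)

Section NumericalRange.
Local Open Scope sesquilinear_scope.
Context {C : numClosedFieldType} {n : nat}.
Implicit Types (x y z : 'cV[C]_n) (A B M Z : 'M[C]_n).

Definition qform A x := dot x (A *m x).
Definition vnorm x : C := sqrtC (dot x x).

Lemma qformE A x : qform A x = \tr (A *m (x *m x^t*)).
Proof. by rewrite mulmxA mxtrace_outer. Qed.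

Lemma vnorm_ge0 x : 0 <= vnorm x.
Proof. by rewrite sqrtC_ge0 dot_ge0. Qed.

Lemma vnormK x : vnorm x ^+ 2 = dot x x.
Proof. exact: sqrtCK. Qed.

Lemma coord_le_vnorm x i : `|x i 0| <= vnorm x.
Proof.
rewrite -(ler_pXn2r (n := 2))// ?nnegrE ?normr_ge0 ?vnorm_ge0//.
rewrite vnormK normCK dotEsum (bigD1 i)//= mulrC lerDl.
by apply: sumr_ge0 => j _; rewrite mulrC mul_conjC_ge0.
Qed.

Lemma form_bound A : exists2 K : C, 0 <= K &
  forall x y, `|dot x (A *m y)| <= K * (vnorm x * vnorm y).
Proof.
exists (\sum_i \sum_j `|A i j|).
  by apply: sumr_ge0 => i _; apply: sumr_ge0 => j _.
move=> x y; rewrite dotEsum mulr_suml.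
apply: (le_trans (ler_norm_sum _ _ _)); apply: ler_sum => i _.
rewrite mxE mulr_sumr mulr_suml.
apply: (le_trans (ler_norm_sum _ _ _)); apply: ler_sum => j _.
rewrite !normrM norm_conjC mulrCA ler_wpM2l//.
by rewrite ler_pM// coord_le_vnorm.
Qed.

Lemma qform_outer x z : qform (x *m x^t*) z = `|dot x z| ^+ 2.
Proof. by rewrite /qform outerMv dotZr normCK -dotC. Qed.

(** The term 2dab, of first order in d, is absorbed into the loss b^2 = 1 - a^2 by completing the
    square, leaving an excess of order d^2; d at most 1/2 keeps the remaining multiple of b^2
    nonnegative. *)
Lemma pencil_bound (a b d : C) : 0 <= a -> 0 <= b -> 0 <= d -> d <= 2^-1 ->
  a ^+ 2 + b ^+ 2 = 1 ->
  a ^+ 2 + d * (2 * (a * b) + b ^+ 2) <= 1 + 2 * d ^+ 2.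
Proof.
move=> a0 b0 d0 d1 ab; rewrite -subr_ge0.
have -> : 1 + 2 * d ^+ 2 - (a ^+ 2 + d * (2 * (a * b) + b ^+ 2)) =
    (b - 2 * d * a) ^+ 2 / 2 + b ^+ 2 * (2^-1 - d) + 2 * d ^+ 2 * b ^+ 2.
  have -> : 1 + 2 * d ^+ 2 = a ^+ 2 + b ^+ 2 + 2 * d ^+ 2 * (a ^+ 2 + b ^+ 2).
    by rewrite ab mulr1.
  by field.
have sqr_ge0 (u v : C) : 0 <= u -> 0 <= v -> 0 <= (u - v) ^+ 2.
  by move=> u0 v0; apply: real_exprn_even_ge0 => //; rewrite realB ?ger0_real.
apply: addr_ge0; first apply: addr_ge0.
- by rewrite mulr_ge0 ?invr_ge0 ?sqr_ge0 ?mulr_ge0.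
- by rewrite mulr_ge0 ?exprn_ge0 ?subr_ge0.
- by rewrite !mulr_ge0 ?exprn_ge0.
Qed.

(** Moving away from x x^* in a direction whose form vanishes at x increases the numerical radius
    only to second order. With z = c x + y, the form of Z at z has no |c|^2 term, which is what
    [pencil_bound] needs. *)
Lemma qform_pencil_bound x Z : dot x x = 1 -> qform Z x = 0 ->
  exists2 K : C, 0 < K & forall (e : C) z, `|e| * K <= 2^-1 -> dot z z = 1 ->
    `|qform (x *m x^t* + e *: Z) z| <= 1 + 2 * (`|e| * K) ^+ 2.
Proof.
move=> xx Zx; have [K0 K0_ge0 HK] := form_bound Z; exists (K0 + 1).
  by rewrite ltr_wpDl.
move=> e z eK zz.
have [c [y [cE xy zE]]] : exists c y, [/\ c = dot x z, dot x y = 0 & z = c *: x + y].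
  exists (dot x z), (z - dot x z *: x).
  by split=> //; [rewrite dotDr -scaleNr dotZr xx mulr1 subrr|rewrite addrC subrK].
have yx : dot y x = 0 by rewrite dotC xy rmorph0.
have nx : vnorm x = 1 by rewrite /vnorm xx sqrtC1.
have cy : `|c| ^+ 2 + vnorm y ^+ 2 = 1.
  rewrite vnormK -zz [in RHS]zE dotDl !dotDr !dotZl !dotZr xy yx xx normCK.
  by ring.
set a := `|c| in cy; set b := vnorm y in cy.
have b0 : 0 <= b by exact: vnorm_ge0.
have bound : `|qform Z z| <= (K0 + 1) * (2 * (a * b) + b ^+ 2).
  rewrite /qform zE mulmxDr dotDl !dotDr -scalemxAr !dotZl !dotZr.
  rewrite -/(qform Z x) Zx !mulr0 add0r.
  have -> : (K0 + 1) * (2 * (a * b) + b ^+ 2) =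
      K0 * (a * b) + K0 * (a * b) + K0 * b ^+ 2 + (2 * (a * b) + b ^+ 2).
    by ring.
  apply: (@le_trans _ _ (K0 * (a * b) + K0 * (a * b) + K0 * b ^+ 2)); last first.
    by rewrite lerDl addr_ge0 ?mulr_ge0 ?exprn_ge0 ?normr_ge0.
  rewrite addrA; apply: (le_trans (ler_normD _ _)); apply: lerD.
    apply: (le_trans (ler_normD _ _)); apply: lerD.
      rewrite normrM norm_conjC mulrCA ler_wpM2l//.
      by have := HK x y; rewrite nx mul1r.
    rewrite normrM mulrCA ler_wpM2l//.
    by have := HK y x; rewrite nx mulr1.
  by have := HK y y; rewrite expr2.
have -> : qform (x *m x^t* + e *: Z) z = qform (x *m x^t*) z + e * qform Z z.
  by rewrite /qform mulmxDl dotDr -scalemxAl dotZr.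
apply: (le_trans (ler_normD _ _)); rewrite qform_outer -cE ger0_norm ?exprn_ge0//.
apply: le_trans (pencil_bound _ b0 _ eK cy); first last.
- by rewrite mulr_ge0 ?normr_ge0// addr_ge0.
- exact: normr_ge0.
by rewrite lerD2l normrM -mulrA ler_wpM2l.
Qed.

(* A rank one projection is an exposed point of the polar of the unit ball of
   the numerical radius. *)
Lemma state_exposed (b : 'M[C]_n -> C) x :
  (forall A B, b (A + B) = b A + b B) -> (forall c A, b (c *: A) = c * b A) ->
  dot x x = 1 ->
  (forall Z, exists2 z, dot z z = 1 & `|b Z| <= `|qform Z z|) ->
  1 <= `|b (x *m x^t*)| ->
  forall Z, b Z = b (x *m x^t*) * qform Z x.
Proof.
move=> bD bZ xx Hb; set m := b _ => m1 Z.
(* Y has zero form at x. If b Y were nonzero, adding a small multiple of Y to x x^* would raise the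
   modulus of b to first order but its bound only to second order. *)
pose Y := Z - qform Z x *: (x *m x^t*).
suff bY : b Y = 0.
  have bYE : b Y = b Z - qform Z x * m by rewrite /Y bD -scaleNr bZ mulNr.
  by apply/eqP; rewrite mulrC -subr_eq0 -bYE bY.
apply/eqP/negPn/negP => bY0.
have Yx : qform Y x = 0.
  rewrite /qform /Y mulmxBl -scalemxAl outerMv xx scale1r dotDr -scaleNr dotZr xx.
  by rewrite mulr1 subrr.
have [K K0 HK] := qform_pencil_bound xx Yx.
pose r := `|b Y|; have r0 : 0 < r by rewrite normr_gt0.
have m0 : m != 0 by rewrite -normr_gt0 (lt_le_trans ltr01).
pose K' := K + r.
have K'0 : 0 < K' by rewrite addr_gt0.
(* Chosen so that the second order term 2 (eps K')^2 is half of the gain eps r; since K' is at least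
   r, also eps K' is at most 1/4. *)
pose eps := r / (4 * K' ^+ 2).
have eps0 : 0 < eps by rewrite divr_gt0 ?mulr_gt0 ?exprn_gt0.
(* Of modulus eps, with the phase that aligns w b(Y) with m, so that the moduli add up. *)
pose w := eps * ((m / `|m|) * ((b Y)^* / r)).
have nw : `|w| = eps.
  rewrite normrM (gtr0_norm eps0) -[RHS]mulr1; congr (_ * _).
  by rewrite !normrM !normfV norm_conjC !normr_id !divff ?normr_eq0// mulr1.
have epsK : eps * K <= eps * K' by rewrite ler_pM2l// lerDl ltW.
have epsK' : eps * K' = r / (4 * K').
  by rewrite /eps; field; rewrite gt_eqF.
have eK : eps * K <= 2^-1.
  apply: (le_trans epsK); rewrite epsK' ler_pdivrMr ?mulr_gt0//.
  have -> : 2^-1 * (4 * K') = K' + K' :> C by field.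
  by rewrite {2}/K' addrA lerDr addr_ge0// ltW.
have [z zz] := Hb (x *m x^t* + w *: Y).
have -> : b (x *m x^t* + w *: Y) = (m / `|m|) * (`|m| + eps * r).
  rewrite bD bZ -/m mulrDr divfK ?normr_eq0//; congr (_ + _).
  transitivity (m / `|m| * (eps * (b Y * (b Y)^* / r))); first by rewrite /w; ring.
  by rewrite -normCK -/r expr2 mulfK ?gt_eqF.
rewrite normrM normrM normfV normr_id divff ?normr_eq0// mul1r.
have nne : 0 <= `|m| + eps * r by rewrite addr_ge0 ?(ltW (mulr_gt0 eps0 r0)).
rewrite (ger0_norm nne).
move=> lo; have := le_trans lo (HK w z _ zz); rewrite nw => /(_ eK) hi.
have {hi} : 1 + eps * r <= 1 + 2 * (eps * K') ^+ 2.
  apply: (le_trans _ (le_trans hi _)).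
    by rewrite lerD2r.
  rewrite lerD2l ler_pM2l// ler_pXn2r// nnegrE mulr_ge0 ?(ltW eps0)//.
    exact: ltW.
  exact: ltW.
have -> : 2 * (eps * K') ^+ 2 = eps * (r / 2).
  by rewrite /eps; field; rewrite gt_eqF.
rewrite lerD2l ler_pM2l// ler_pdivlMr// mulr_natr mulr2n gerDl.
by move=> /(lt_le_trans r0); rewrite ltxx.
Qed.


(** Comparison of numerical radii without suprema, meaningful over any numerically closed field. *)
Definition qform_le A B :=
  forall x, dot x x = 1 -> exists2 y, dot y y = 1 & `|qform A x| <= `|qform B y|.

(** Kept as a hypothesis so that the matrix argument stays algebraic; compactness provides it over
    [R[i]]. *)
Definition qform_max_attained := forall A,
  exists2 y, dot y y = 1 & forall x, dot x x = 1 -> `|qform A x| <= `|qform A y|.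

Lemma unit_cauchy_schwarz x z : dot x x = 1 -> dot z z = 1 -> `|dot x z| <= 1.
Proof.
move=> xx zz; rewrite -(ler_pXn2r (n := 2))// ?nnegrE// expr1n.
have [c [y [cE xy zE]]] : exists c y, [/\ c = dot x z, dot x y = 0 & z = c *: x + y].
  exists (dot x z), (z - dot x z *: x).
  by split=> //; [rewrite dotDr -scaleNr dotZr xx mulr1 subrr|rewrite addrC subrK].
rewrite -cE -zz zE dotDl !dotDr !dotZl !dotZr xy (dotC y x) xy xx rmorph0.
by rewrite !mulr0 mulr1 addr0 add0r normCK mulrC lerDl dot_ge0.
Qed.

(** Take y where the form of G(x x^* ) has maximal modulus. The functional Z -> <G(Z) y, y> is
    bounded by the numerical radius because of [Gle], and has modulus at least 1 at x x^* because of
    [Fle]. Exposedness makes it a multiple of the state at x; substituting F Z for Z concludes. *)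
Lemma preserver_dual_state (F G : {linear 'M[C]_n -> 'M[C]_n}) :
  qform_max_attained -> cancel F G -> cancel G F ->
  (forall A, qform_le (F A) A) -> (forall A, qform_le (G A) A) ->
  forall x, dot x x = 1 -> exists2 y, dot y y = 1 &
    exists2 c : C, `|c| = 1 & forall Z, qform (F Z) x = c * qform Z y.
Proof.
move=> att FK GK Fle Gle x xx.
have [y yy ymax] := att (G (x *m x^t*)); exists y => //.
pose b Z := qform (G Z) y; pose m := b (x *m x^t*).
have bb Z : exists2 z, dot z z = 1 & `|b Z| <= `|qform Z z| by exact: Gle.
have m1 : 1 <= `|m|.
  have [z zz] := Fle (G (x *m x^t*)) x xx.
  rewrite GK qform_outer xx normr1 expr1n normr1 => h.
  by rewrite (le_trans h)// ymax.
have bE : forall Z, b Z = m * qform Z x.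
  apply: state_exposed => //.
    by move=> A B; rewrite /b linearD /qform mulmxDl dotDr.
  by move=> c A; rewrite /b linearZ/= /qform -scalemxAl dotZr.
have nm : `|m| = 1.
  apply/eqP; rewrite eq_le m1 andbT; have [z zz h] := bb (x *m x^t*).
  apply: (le_trans h); rewrite qform_outer normrX normr_id exprn_ile1//.
  exact: unit_cauchy_schwarz.
have m0 : m != 0 by rewrite -normr_eq0 nm oner_eq0.
exists m^-1; first by rewrite normfV nm invr1.
by move=> Z; rewrite -[Z in RHS]FK -[qform (G _) _]/(b _) bE mulKf.
Qed.

End NumericalRange.

(** * Numerical radius preservers *)

Section Preservers.
Local Open Scope sesquilinear_scope.
Context {C : numClosedFieldType} {n : nat}.
Implicit Types (x y z : 'cV[C]_n) (A B M Z : 'M[C]_n).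

Lemma qformZ A c x : qform A (c *: x) = (c * c^*) * qform A x.
Proof. by rewrite /qform -scalemxAr dotZl dotZr mulrA (mulrC c). Qed.

Lemma unit_scale x : exists c : C, exists2 u, x = c *: u & (0 < n)%N -> dot u u = 1.
Proof.
have [->|x0] := eqVneq x 0.
  exists 0; have [n0|n0] := posnP n.
    by exists 0; rewrite ?scaler0// n0.
  exists (delta_mx (Ordinal n0) 0); rewrite ?scale0r// => _.
  by rewrite /dot adjmx_delta mul_delta_mx mxE !eqxx.
have v0 : vnorm x != 0 by rewrite sqrtC_eq0 dot_eq0.
exists (vnorm x), ((vnorm x)^-1 *: x); first by rewrite scalerA divff// scale1r.
move=> _; rewrite dotZl dotZr mulrA -vnormK expr2.
rewrite geC0_conj ?invr_ge0 ?vnorm_ge0//.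
by rewrite mulrA mulfVK// mulVf.
Qed.

(** At x + t c y the hypothesis becomes |a + t s + t^2 |c|^2 b|^2 = (1 + t^2 |c|^2)^2, a polynomial
    identity in real t; each coefficient is then separated in c. *)
Lemma unimodular_ortho M x y :
  (forall z, `|qform M z| = dot z z) -> dot x x = 1 -> dot y y = 1 ->
  dot x y = 0 -> dot x (M *m y) = 0 /\ qform M x = qform M y.
Proof.
move=> HM xx yy xy; have yx : dot y x = 0 by rewrite dotC xy rmorph0.
pose a := qform M x; pose b := qform M y.
pose p := dot x (M *m y); pose q := dot y (M *m x).
have HM2 z : qform M z * (qform M z)^* = dot z z ^+ 2 by rewrite -normCK HM.
have aa : a * a^* = 1 by rewrite /a HM2 xx expr1n.
have bb : b * b^* = 1 by rewrite /b HM2 yy expr1n.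
have main c (s := c * p + c^* * q) :
    a * s^* + a^* * s = 0 /\
    (c * c^*) * (a * b^* + a^* * b) + s * s^* - 2 * (c * c^*) = 0.
  (* The last entry is trivial: the coefficients of t^4 cancel since |b| = 1, as the constant ones
     do since |a| = 1. *)
  suff [] : [/\ a * s^* + a^* * s = 0,
      (c * c^*) * (a * b^* + a^* * b) + s * s^* - 2 * (c * c^*) = 0,
      (c * c^*) * (b * s^* + b^* * s) = 0 & (0 : C) = 0] by [].
  apply: poly4_eq0 => t tR.
  have qE : qform M (x + (t * c) *: y) = a + t * s + t ^+ 2 * (c * c^*) * b.
    rewrite /qform mulmxDr -scalemxAr dotDl !dotDr !dotZl !dotZr rmorphM/= tR.
    rewrite -/(qform M x) -/(qform M y) -/a -/b -/p -/q /s; ring.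
  have dE : dot (x + (t * c) *: y) (x + (t * c) *: y) = 1 + t ^+ 2 * (c * c^*).
    by rewrite dotDl !dotDr !dotZl !dotZr rmorphM/= tR xx yy xy yx; ring.
  have := HM2 (x + (t * c) *: y); rewrite qE dE.
  rewrite !(rmorphD, rmorphM, rmorphXn)/= conjCK tR => /eqP; rewrite -subr_eq0 => /eqP E.
  rewrite mulr0 addr0 -[RHS]E.
  have -> : (1 + t ^+ 2 * (c * c^*)) ^+ 2 =
      a * a^* + t ^+ 2 * (2 * (c * c^*)) + t ^+ 4 * (c * c^*) ^+ 2 * (b * b^*).
    by rewrite aa bb; ring.
  by ring.
(* The c^2 part of |s|^2 in the second equation; all the rest is a multiple of |c|^2 or of the
   conjugate of c^2. *)
have pq : p * q^* = 0.
  pose d : C := 2 - (a * b^* + a^* * b) - p * p^* - q * q^*.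
  apply: (@conj_quad_comb_eq0 _ C^o _ (p^* * q) d) => c.
  have [_ /eqP] := main c; rewrite rmorphD !rmorphM/= conjCK.
  rewrite subr_eq0 => /eqP E.
  transitivity (c ^+ 2 * (p * q^*) + c^* ^+ 2 * (p^* * q)); first by [].
  transitivity ((c * c^*) * d) => //.
  have -> : c * c^* * d = 2 * (c * c^*)
      - c * c^* * (a * b^* + a^* * b + p * p^* + q * q^*) by rewrite /d; ring.
  by rewrite -E; ring.
have apq : a * q^* + a^* * p = 0.
  apply: (@conj_comb_eq0 _ C^o _ (a * p^* + a^* * q)) => c.
  have [+ _] := main c; rewrite rmorphD !rmorphM/= conjCK => <-.
  transitivity (c * (a * q^* + a^* * p) + c^* * (a * p^* + a^* * q)); first by [].
  by ring.
have a0 : a != 0 by apply/eqP => a0; move/eqP: aa; rewrite a0 mul0r eq_sym oner_eq0.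
have p0 : p = 0.
  have : p * (a * q^* + a^* * p) = a^* * (p * p) by rewrite mulrDr mulrCA pq mulr0 add0r; ring.
  rewrite apq mulr0 => /esym/eqP; rewrite !mulf_eq0 conjC_eq0 (negPf a0) orbb.
  by move/eqP.
have q0 : q = 0.
  move/eqP: apq; rewrite p0 mulr0 addr0 mulf_eq0 (negPf a0) conjC_eq0.
  by move/eqP.
split=> //; have [_] := main 1; rewrite p0 q0 rmorph1 !mulr0 addr0 !mul1r mul0r addr0 mulr1.
move=> E; apply/eqP; rewrite -subr_eq0 -mul_conjC_eq0; apply/eqP.
rewrite rmorphB -/a -/b; transitivity (a * a^* + b * b^* - (a * b^* + a^* * b)); first
  by rewrite /=; ring.
by rewrite aa bb -[RHS]oppr0 -E; ring.
Qed.

(** The numerical range lies on the unit circle; comparing pairs of basis vectors kills the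
    off-diagonal entries and equates the diagonal ones. *)
Lemma unimodular_scalar M : (0 < n)%N ->
  (forall x, dot x x = 1 -> `|qform M x| = 1) ->
  exists2 c, `|c| = 1 & M = c%:M.
Proof.
move=> n0 H1.
have HM z : `|qform M z| = dot z z.
  have [c [u -> /(_ n0) uu]] := unit_scale z.
  rewrite qformZ dotZl dotZr uu mulr1 normrM H1// mulr1.
  by rewrite ger0_norm ?mul_conjC_ge0// mulrC.
pose e i : 'cV[C]_n := delta_mx i 0.
have eM i j : dot (e i) (M *m e j) = M i j.
  by rewrite /dot adjmx_delta -colE -rowE !mxE.
have ee i j : dot (e i) (e j) = (i == j)%:R.
  by rewrite /dot adjmx_delta -rowE !mxE eqxx andbT.
exists (M (Ordinal n0) (Ordinal n0)).
  by rewrite -eM; apply: H1; rewrite ee eqxx.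
apply/matrixP => i j; rewrite mxE; have [<-|ij] := eqVneq i j.
  have [->//|i0] := eqVneq i (Ordinal n0); rewrite mulr1n.
  have [|||_] := @unimodular_ortho M (e i) (e (Ordinal n0)) HM; rewrite ?ee ?eqxx ?(negPf i0)//.
  by rewrite /qform !eM.
have [|||+ _] := @unimodular_ortho M (e i) (e j) HM; rewrite ?ee ?eqxx ?(negPf ij)//.
by rewrite eM mulr0n.
Qed.

(** The phases at the various x agree because F 1 is scalar: its form is unimodular. After division
    by this common phase, the trace dual of F preserves rank one positive matrices, and the
    classification is carried back through the trace pairing. *)
Lemma preserver_form (F G : {linear 'M[C]_n -> 'M[C]_n}) :
  (0 < n)%N -> @qform_max_attained C n -> cancel F G -> cancel G F ->
  (forall A, qform_le (F A) A) -> (forall A, qform_le (G A) A) ->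
  exists2 c : C, `|c| = 1 & exists2 V : 'M[C]_n, V \is unitarymx &
    (forall Z, F Z = c *: (V *m Z *m V^t*)) \/
    (forall Z, F Z = c *: (V *m Z^T *m V^t*)).
Proof.
move=> n0 att FK GK Fle Gle.
have dual := preserver_dual_state att FK GK Fle Gle.
have q1 x : dot x x = 1 -> qform 1%:M x = 1 by rewrite /qform mul1mx.
have [c nc F1] : exists2 c, `|c| = 1 & F 1%:M = c%:M.
  apply: unimodular_scalar => // x xx; have [y yy [c nc ->]] := dual x xx.
  by rewrite q1// mulr1.
have c0 : c != 0 by rewrite -normr_eq0 nc oner_eq0.
exists c => //.
(* The adjoint of c^-1 F for the bilinear form tr(A B), written entrywise; [DE] is its defining
   property. *)
pose d X : 'M[C]_n := \matrix_(i, j) (c^-1 * \tr (F (delta_mx j i) *m X)).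
have lin_d : linear d.
  move=> a A B; apply/matrixP => i j.
  by rewrite !mxE mulmxDr -scalemxAr mxtraceD mxtraceZ; ring.
pose D : {linear 'M[C]_n -> 'M[C]_n} :=
  HB.pack d (GRing.isLinear.Build _ _ _ _ d lin_d).
have DE X Z : \tr (D X *m Z) = c^-1 * \tr (F Z *m X).
  rewrite [Z in LHS]matrix_sum_delta [Z in RHS]matrix_sum_delta.
  rewrite mulmx_sumr !linear_sum mulmx_suml linear_sum mulr_sumr/=.
  apply: eq_bigr => i _; rewrite mulmx_sumr !linear_sum mulmx_suml linear_sum mulr_sumr/=.
  apply: eq_bigr => j _; rewrite -scalemxAr !linearZ/= -scalemxAl mxtraceZ mxtrace_delta.
  by rewrite [d X _ _]mxE; ring.
have DZ s X : D (s *: X) = s *: D X by exact: linearZ.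
have rpD : rank1_preserving D.
  split.
  - move=> X; rewrite -[D X]mulmx1 DE F1 mul_scalar_mx mxtraceZ mulrA.
    by rewrite mulVf// mul1r.
  - move=> X Y eXY; apply: mxtrace_mul_inj => Z; rewrite -(GK Z).
    apply: (mulfI (invr_neq0 c0)).
    by rewrite !(mxtrace_mulC _ (F _)) -!DE eXY.
  - move=> x; have [s [u -> /(_ n0) uu]] := unit_scale x.
    have [y yy [m nm Hm]] := dual u uu.
    have mc : m = c.
      by have := Hm 1%:M; rewrite q1// F1 mulr1 /qform mul_scalar_mx dotZr uu mulr1.
    exists (s *: y); rewrite !adjmxZ -!scalemxAl -!scalemxAr !DZ.
    do 2!congr (_ *: _); apply: mxtrace_mul_inj => Z.
    by rewrite DE -qformE Hm mc mulKf// qformE mxtrace_mulC.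
have [V uV LV] := rank1_preservingP n0 rpD.
have FE X Z : \tr (F Z *m X) = c * \tr (D X *m Z) by rewrite DE mulVKf.
case: LV => LV.
- exists (V^t*); first by rewrite trmxC_unitary.
  left=> Z; apply: mxtrace_mul_inj => X.
  rewrite FE LV -scalemxAl mxtraceZ trmxCK -[V *m X *m _ *m _]mulmxA.
  by rewrite mxtrace_mulC !mulmxA.
- exists (V^T); first by rewrite trmx_unitary.
  right=> Z; apply: mxtrace_mul_inj => X.
  rewrite FE LV -scalemxAl mxtraceZ -[in RHS]mxtrace_tr; congr (_ * _).
  rewrite !trmx_mul !trmxK map_trmx -!mulmxA mxtrace_mulC -!mulmxA.
  by [].
Qed.

End Preservers.

(** * Pseudoreflections *)

Section Reflections.
Local Open Scope sesquilinear_scope.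
Context {C : numClosedFieldType} {n : nat}.
Implicit Types (x y z : 'cV[C]_n) (A B M Z : 'M[C]_n).

(** For unit x: eigenvalue c on x and 1 on its orthogonal complement. A general c makes square roots
    available inside the family. *)
Definition pseudoreflection (c : C) x : 'M[C]_n := 1%:M + (c - 1) *: (x *m x^t*).

Lemma pseudoreflectionM c d x : dot x x = 1 ->
  pseudoreflection c x *m pseudoreflection d x = pseudoreflection (c * d) x.
Proof.
move=> xx; rewrite /pseudoreflection mulmxDl !mulmxDr !mul1mx mulmx1.
rewrite -scalemxAl -scalemxAr outerM xx scale1r; move: (x *m _) => P.
by apply/matrixP => i j; rewrite !mxE; ring.
Qed.

Lemma pseudoreflection_adj c x : (pseudoreflection c x)^t* = pseudoreflection c^* x.
Proof.
by rewrite /pseudoreflection adjmxD adjmx1 adjmxZ outer_adj rmorphB/= conjC1.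
Qed.

Lemma pseudoreflection1 x : pseudoreflection 1 x = 1%:M.
Proof. by rewrite /pseudoreflection subrr scale0r addr0. Qed.

Lemma pseudoreflection_unitary c x : dot x x = 1 -> c * c^* = 1 ->
  pseudoreflection c x \is unitarymx.
Proof.
move=> xx cc; apply/unitarymxP.
by rewrite pseudoreflection_adj pseudoreflectionM// cc pseudoreflection1.
Qed.

Lemma mxtrace_pseudoreflection c x : dot x x = 1 ->
  \tr (pseudoreflection c x) = n%:R - 1 + c.
Proof.
move=> xx; rewrite mxtraceD mxtraceZ mxtrace_outer xx mulr1 mxtrace1.
by rewrite addrA addrAC.
Qed.

Lemma comm_pseudoreflection A c x : c != 1 ->
  A *m pseudoreflection c x = pseudoreflection c x *m A ->
  A *m (x *m x^t*) = x *m x^t* *m A.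
Proof.
move=> c1; rewrite /pseudoreflection mulmxDr mulmxDl mulmx1 mul1mx => /addrI.
by rewrite -scalemxAr -scalemxAl => /scalerI -> //; rewrite subr_eq0.
Qed.

Lemma pseudoreflection_comm A c x :
  A *m (x *m x^t*) = x *m x^t* *m A ->
  A *m pseudoreflection c x = pseudoreflection c x *m A.
Proof.
move=> Ax; rewrite /pseudoreflection mulmxDr mulmxDl mulmx1 mul1mx.
by rewrite -scalemxAr -scalemxAl Ax.
Qed.

Lemma unitary_comm A U : U \is unitarymx -> U *m A *m U^t* = A -> A *m U = U *m A.
Proof. by move=> uU UA; rewrite -{1}UA mulmxKtV. Qed.


Lemma central_scalar A : (0 < n)%N -> (forall Z, A *m Z = Z *m A) ->
  exists a, A = a%:M.
Proof.
move=> n0 HA.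
have H i j k l : A k i * (l == j)%:R = (k == i)%:R * A j l.
  have /matrixP/(_ k l) := HA (delta_mx i j).
  rewrite -(mul_delta_mx (0 : 'I_1)) mulmxA -colE -mulmxA -rowE.
  by rewrite !mxE !big_ord1 !mxE eqxx andbT.
exists (A (Ordinal n0) (Ordinal n0)); apply/matrixP => i j; rewrite mxE.
have := H i (Ordinal n0) i (Ordinal n0); rewrite !eqxx mulr1 mul1r => Aii.
have [<-|ij] := eqVneq i j; first by rewrite Aii mulr1n.
have := H i i i j; rewrite eq_sym (negPf ij) eqxx mulr0 mul1r => <-.
by rewrite mulr0n.
Qed.

Lemma comm_outer_scalar A : (0 < n)%N ->
  (forall x, dot x x = 1 -> A *m (x *m x^t*) = x *m x^t* *m A) ->
  exists a, A = a%:M.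
Proof.
move=> n0 HA; apply: central_scalar => // Z; apply/eqP; rewrite -subr_eq0; apply/eqP.
pose d X := A *m X - X *m A.
have lin_d : linear d.
  move=> a X Y; rewrite /d mulmxDl mulmxDr -scalemxAl -scalemxAr.
  by rewrite scalerBr addrACA opprD.
pose dl : {linear 'M[C]_n -> 'M[C]_n} :=
  HB.pack d (GRing.isLinear.Build _ _ _ _ d lin_d).
rewrite -[LHS]/(dl Z); apply: outer_span => x.
have [s [u -> /(_ n0) uu]] := unit_scale x.
rewrite adjmxZ -scalemxAl -scalemxAr -[LHS]/(d _) /d -!scalemxAr -!scalemxAl.
by rewrite HA// subrr.
Qed.

(** In a full rank factorization A = c d, idempotence gives d c = 1, so the trace is the rank.
    Self-adjointness then replaces d by a multiple of c^*. *)
Lemma trace_one_projection A : A *m A = A -> A^t* = A -> \tr A = 1 ->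
  exists2 y, dot y y = 1 & A = y *m y^t*.
Proof.
move=> AA adjA trA.
have [r [c [d [cd dc]]]] : exists r (c : 'M[C]_(n, r)) (d : 'M[C]_(r, n)),
    c *m d = A /\ d *m c = 1%:M.
  exists (\rank A), (col_base A), (row_base A).
  split; first exact: mulmx_base.
  have := mulmx_base A; have := mulVpmx (col_base_full A).
  have := mulmxVp (row_base_free A).
  move: (row_base A) (col_base A) (pinvmx (row_base A)) (pinvmx (col_base A)).
  move=> d c d' c' dd cc cd; have : c *m d *m (c *m d) = c *m d by rewrite cd.
  move=> /(congr1 (fun X => c' *m X *m d')); rewrite !mulmxA cc !mul1mx.
  by rewrite -!mulmxA dd !mulmx1.
have r1 : r = 1%N.
  apply/eqP; rewrite -(eqr_nat C); apply/eqP.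
  by rewrite -[r%:R]mxtrace1 -dc mxtrace_mulC cd.
subst r; pose w := d^t*.
have AE : A = c *m w^t* by rewrite /w trmxCK cd.
have AE2 : A = dot w w *: (c *m c^t*).
  by rewrite -{1}AA -{2}adjA {1}AE {1}AE outer_adj outerM.
exists (vnorm w *: c).
  rewrite dotZl dotZr mulrA (geC0_conj (vnorm_ge0 _)) -expr2 vnormK.
  by rewrite -(mxtrace_outer c c) -mxtraceZ -AE2.
rewrite adjmxZ -scalemxAl -scalemxAr scalerA (geC0_conj (vnorm_ge0 _)).
by rewrite -expr2 vnormK.
Qed.

(** A phase, which z z^* does not see, makes the inner product of x and z real and nonnegative. The
    Householder reflection along the difference then exchanges the two vectors; realness is what
    makes it work. *)
Lemma unitary_transitive x z : dot x x = 1 -> dot z z = 1 ->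
  exists2 U, U \is unitarymx & U *m (x *m x^t*) *m U^t* = z *m z^t*.
Proof.
move=> xx zz.
have [t tt rR] : exists2 t : C, t * t^* = 1 & 0 <= dot x (t *: z).
  have [d0|d0] := eqVneq (dot x z) 0.
    by exists 1; rewrite ?rmorph1 ?mulr1// scale1r d0.
  exists ((dot x z)^* / `|dot x z|).
    rewrite -normCK normrM normfV norm_conjC normr_id divff ?normr_eq0//.
    by rewrite expr1n.
  by rewrite dotZr mulrAC mulr_ge0 ?invr_ge0// mulrC mul_conjC_ge0.
have [y [yy yzE yR]] : exists y, [/\ dot y y = 1, y *m y^t* = z *m z^t* & 0 <= dot x y].
  exists (t *: z); split=> //; first by rewrite dotZl dotZr zz mulr1 mulrC.
  by rewrite adjmxZ -scalemxAl -scalemxAr scalerA tt scale1r.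
pose r := dot x y.
have yxr : dot y x = r by rewrite dotC -/r geC0_conj.
suff [U uU Ux] : exists2 U, U \is unitarymx & U *m x = y.
  by exists U => //; rewrite -yzE -Ux adjmxM !mulmxA.
have [xy|xy] := eqVneq x y.
  by exists 1%:M; rewrite ?mul1mx//; apply/unitarymxP; rewrite mul1mx adjmx1.
have [u uE] : exists u, u = x - y by exists (x - y).
have uuE : dot u u = 2 * (1 - r).
  rewrite uE dotDl !dotDr -scaleN1r !dotZl !dotZr yxr -/r xx yy rmorphN rmorph1.
  by ring.
have u0 : u != 0 by rewrite uE subr_eq0.
have v0 : vnorm u != 0 by rewrite sqrtC_eq0 dot_eq0.
have [w wE] : exists w, w = (vnorm u)^-1 *: u by exists ((vnorm u)^-1 *: u).
have vC : ((vnorm u)^-1)^* = (vnorm u)^-1.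
  by rewrite geC0_conj ?invr_ge0 ?vnorm_ge0.
have ww : dot w w = 1.
  rewrite wE dotZl dotZr vC mulrA -vnormK expr2.
  by rewrite mulrA mulfVK// mulVf.
exists (pseudoreflection (-1) w).
  by apply: pseudoreflection_unitary => //; rewrite rmorphN rmorph1 mulrNN mulr1.
have ux : dot u x = 1 - r.
  by rewrite uE dotDl -scaleN1r dotZl xx yxr rmorphN rmorph1 mulN1r.
rewrite /pseudoreflection mulmxDl mul1mx -scalemxAl outerMv wE dotZl vC !scalerA ux.
have -> : (-1 - 1) * ((vnorm u)^-1 * (1 - r)) * (vnorm u)^-1 = -1 :> C.
  have -> : (-1 - 1) * ((vnorm u)^-1 * (1 - r)) * (vnorm u)^-1 =
      - ((2 * (1 - r)) / (vnorm u ^+ 2)) by field.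
  by rewrite vnormK -uuE divff// dot_eq0.
by rewrite scaleN1r uE opprB addrC subrK.
Qed.

End Reflections.

(** * Maps compatible with unitary conjugation *)

Section OperatorTrace.
Local Open Scope sesquilinear_scope.
Context {C : numClosedFieldType} {n : nat}.
Implicit Types (A B M Z : 'M[C]_n).

(** The trace of F as an endomorphism of the n^2-dimensional matrix space, in the basis of matrix
    units. Its invariance under conjugation by [phi] is what makes it useful. *)
Definition optrace (F : 'M[C]_n -> 'M[C]_n) :=
  \sum_(p : 'I_n * 'I_n) F (delta_mx p.1 p.2) p.1 p.2.

Lemma optraceC (F G : {linear 'M[C]_n -> 'M[C]_n}) :
  optrace (F \o G) = optrace (G \o F).
Proof.
have comp (K L : {linear 'M[C]_n -> 'M[C]_n}) : optrace (K \o L) =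
    \sum_p \sum_(q : 'I_n * 'I_n)
      L (delta_mx p.1 p.2) q.1 q.2 * K (delta_mx q.1 q.2) p.1 p.2.
  apply: eq_bigr => p _ /=; rewrite {1}(matrix_sum_delta (L _)) linear_sum.
  rewrite summxE -(pair_bigA _ (fun i j =>
    L (delta_mx p.1 p.2) i j * K (delta_mx i j) p.1 p.2)).
  apply: eq_bigr => i _; rewrite linear_sum summxE; apply: eq_bigr => j _.
  by rewrite linearZ mxE.
rewrite !comp exchange_big; apply: eq_bigr => p _; apply: eq_bigr => q _.
by rewrite mulrC.
Qed.

(** Z -> V Z V^* is the tensor product of V with its conjugate, whose trace is |tr V|^2. *)
Lemma optrace_congr (c : C) V :
  optrace (fun Z => c *: (V *m Z *m V^t*)) = c * (\tr V * (\tr V)^*).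
Proof.
rewrite /optrace -mxtrace_adj /mxtrace big_distrlr/= pair_bigA/=.
rewrite mulr_sumr; apply: eq_bigr => -[i j] _ /=.
rewrite mxE -(mul_delta_mx (0 : 'I_1)) mulmxA -colE -mulmxA -rowE.
by rewrite !mxE big_ord1 !mxE.
Qed.

End OperatorTrace.

(** * Conjugations transported by the preserver, and the classification for matrices *)

Section MatrixTheorem.
Local Open Scope sesquilinear_scope.
Context {C : numClosedFieldType} {n : nat}.
Implicit Types (x y z : 'cV[C]_n) (A B M Z S U V : 'M[C]_n).
Variables (phi psi : {linear 'M[C]_n -> 'M[C]_n}).
Hypothesis n_ge2 : (1 < n)%N.
Hypothesis att : @qform_max_attained C n.
Hypothesis phiK : cancel phi psi.
Hypothesis psiK : cancel psi phi.
Hypothesis phi_le : forall U A, U \is unitarymx ->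
  qform_le (phi (U *m A *m U^t*)) (phi A).

Let n_gt0 : (0 < n)%N := ltnW n_ge2.

Let nat1 : (n%:R : C) != 0. Proof. by rewrite pnatr_eq0 -lt0n. Qed.

(** Multiplicative in U, so squares and commutation relations between unitaries pass to their
    twists. *)
Definition twist U Z := phi (U *m psi Z *m U^t*).

Lemma twist_linear U : linear (twist U).
Proof. by move=> a A B; rewrite /twist linearP mulmxDr mulmxDl -scalemxAr -scalemxAl linearP. Qed.

HB.instance Definition _ U :=
  GRing.isLinear.Build _ _ _ _ (twist U) (twist_linear U).

Lemma twistM U V Z : twist U (twist V Z) = twist (U *m V) Z.
Proof. by rewrite /twist phiK adjmxM !mulmxA. Qed.

Lemma twist1 Z : twist 1%:M Z = Z.
Proof. by rewrite /twist adjmx1 mul1mx mulmx1 psiK. Qed.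

Lemma twistK U : U \is unitarymx -> cancel (twist U) (twist (U^t*)).
Proof.
move=> uU Z; rewrite twistM; have : U^t* \is unitarymx by rewrite trmxC_unitary.
by move=> /unitarymxP; rewrite trmxCK => ->; exact: twist1.
Qed.

Lemma twistVK U : U \is unitarymx -> cancel (twist (U^t*)) (twist U).
Proof. by move=> /unitarymxP uU Z; rewrite twistM uU twist1. Qed.

Lemma twist_form_phase U : U \is unitarymx ->
  exists2 c : C, `|c| = 1 & exists2 V, V \is unitarymx &
    (forall Z, twist U Z = c *: (V *m Z *m V^t*)) \/
    (forall Z, twist U Z = c *: (V *m Z^T *m V^t*)).
Proof.
have tle W A : W \is unitarymx -> qform_le (twist W A) A.
  by move=> uW; rewrite -{2}(psiK A); exact: phi_le.
move=> uU; apply: (preserver_form n_gt0 att (twistK uU) (twistVK uU)).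
- by move=> A; exact: tle.
- by move=> A; apply: tle; rewrite trmxC_unitary.
Qed.

Lemma optrace_twist U : optrace (twist U) = \tr U * (\tr U)^*.
Proof.
pose K : {linear 'M[C]_n -> 'M[C]_n} := mulmxr (U^t*) \o mulmx U.
transitivity (optrace (phi \o (K \o psi))); first by [].
rewrite optraceC -[RHS]mul1r -optrace_congr; apply: eq_bigr => p _.
by rewrite /= phiK scale1r.
Qed.

(* A square kills the antiautomorphism alternative; the operator trace then
   determines the phase. *)
Lemma twist_square S : S \is unitarymx ->
  exists2 c : C, `|c| = 1 & exists2 V, V \is unitarymx &
    (forall Z, twist (S *m S) Z = c *: (V *m Z *m V^t*)) /\
    c * (\tr V * (\tr V)^*) = \tr (S *m S) * (\tr (S *m S))^*.
Proof.
move=> uS; have [c nc [V uV HV]] := twist_form_phase uS.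
exists (c * c); first by rewrite normrM nc mulr1.
suff [W uW HW] : exists2 W, W \is unitarymx &
    forall Z, twist (S *m S) Z = (c * c) *: (W *m Z *m W^t*).
  exists W => //; split=> //; rewrite -optrace_congr -optrace_twist.
  by apply: eq_bigr => p _; rewrite HW.
case: HV => HV.
- exists (V *m V); first exact: mul_unitarymx.
  move=> Z; rewrite -twistM !HV -scalemxAr -scalemxAl scalerA adjmxM.
  by rewrite !mulmxA.
(* Applying Z -> V Z^T V^* twice transposes twice: the result is conjugation by V times its
   entrywise conjugate. *)
- exists (V *m map_mx Num.conj V); first by rewrite mul_unitarymx// conjC_unitary.
  move=> Z; rewrite -twistM !HV linearZ/= -scalemxAr -scalemxAl scalerA adjmxM.
  have -> : (map_mx Num.conj V)^t* = V^T by apply/matrixP => i j; rewrite !mxE conjCK.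
  by rewrite !trmx_mul trmxK map_trmx trmxK !mulmxA.
Qed.

(** For the pseudoreflection of eigenvalue i the trace n - 1 + i is never 0, so its twist has phase
    1 and fixes the identity. Hence [psi 1] commutes with all these pseudoreflections, that is, with
    every x x^*. *)
Lemma psi1_scalar : exists2 a, a != 0 & psi 1%:M = a%:M.
Proof.
suff [a aE] : exists a, psi 1%:M = a%:M.
  exists a => //; apply/eqP => a0; move: (psiK 1%:M); rewrite aE a0.
  rewrite raddf0 linear0 => /(congr1 mxtrace); rewrite mxtrace0 mxtrace1.
  by move/esym/eqP; rewrite (negPf nat1).
apply: comm_outer_scalar => // x xx.
have i1 : 'i != 1 :> C.
  apply/eqP => i1; have := @conjCi C; rewrite i1 conjC1 => /eqP.
  by rewrite -addr_eq0 -mulr2n pnatr_eq0.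
apply: (comm_pseudoreflection i1).
(* The square root through which the pseudoreflection of eigenvalue i is a square, as [twist_square]
   requires. *)
pose s : C := sqrtC 'i.
have ss : s * s^* = 1 by rewrite -normCK -normrX sqrtCK normCi.
have uS := pseudoreflection_unitary xx ss.
have RE : pseudoreflection s x *m pseudoreflection s x = pseudoreflection 'i x.
  by rewrite pseudoreflectionM// -expr2 sqrtCK.
have uR : pseudoreflection 'i x \is unitarymx by rewrite -RE mul_unitarymx.
have [c nc [V uV [HV trV]]] := twist_square uS.
have c1 : c = 1.
  move: trV; set t := (X in _ = X) => trV; have t0 : 0 < t.
    rewrite /t.
    rewrite lt_def mul_conjC_ge0 andbT mul_conjC_eq0 RE mxtrace_pseudoreflection//.
    apply/eqP => ti; have := congr1 Num.conj ti.
    rewrite !(rmorphD, rmorphN)/= conjC1 conjC_nat conjC0 conjCi => /eqP.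
    rewrite -[X in _ == X]ti (inj_eq (addrI _)) eq_sym -addr_eq0 -mulr2n mulrn_eq0/=.
    by rewrite (negPf (neq0Ci _)).
  have : `|c * (\tr V * (\tr V)^*)| = \tr V * (\tr V)^*.
    by rewrite normrM nc mul1r ger0_norm ?mul_conjC_ge0.
  rewrite trV ger0_norm ?(ltW t0)// => tE; move: trV; rewrite -tE => /eqP.
  by rewrite -{2}[t]mul1r (inj_eq (mulIf (lt0r_neq0 t0))) => /eqP.
apply: unitary_comm => //.
move: (HV 1%:M); rewrite c1 scale1r mulmx1 (unitarymxP uV) RE /twist.
by move/(congr1 psi); rewrite phiK.
Qed.

(** A scalar [psi 1] is unchanged by conjugation, so the twist fixes the identity and the phase must
    be 1. *)
Lemma twist_form U : U \is unitarymx -> exists2 V, V \is unitarymx &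
    (forall Z, twist U Z = V *m Z *m V^t*) \/
    (forall Z, twist U Z = V *m Z^T *m V^t*).
Proof.
move=> uU; have [c nc [V uV HV]] := twist_form_phase uU; exists V => //.
have [a a0 p1] := psi1_scalar.
have U1 : twist U 1%:M = 1%:M.
  by rewrite /twist p1 mul_mx_scalar -scalemxAl (unitarymxP uU) scalemx1 -p1 psiK.
suff c1 : c = 1 by move: HV; rewrite c1; case=> HV; [left|right] => Z; rewrite HV scale1r.
have : twist U 1%:M = c *: 1%:M.
  by case: HV => ->; rewrite ?trmx1 mulmx1 (unitarymxP uV).
rewrite U1 => /(congr1 mxtrace); rewrite mxtraceZ mxtrace1 -{1}[n%:R]mul1r.
by move/(mulIf nat1).
Qed.

Lemma twist_id U : U \is unitarymx -> twist U 1%:M = 1%:M.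
Proof.
by move=> uU; have [V /unitarymxP uV [] ->] := twist_form uU; rewrite ?trmx1 mulmx1.
Qed.

(** The Jordan triple product A B A is insensitive to reversing the order of factors, so it handles
    both alternatives at once. *)
Lemma twist_triple U A B : U \is unitarymx ->
  twist U (A *m B *m A) = twist U A *m twist U B *m twist U A.
Proof.
move=> uU; have [V uV [] HV] := twist_form uU; rewrite !HV.
  by rewrite !mulmxA !mulmxKtV.
by rewrite !trmx_mul !mulmxA !mulmxKtV.
Qed.

(* The projection q is read off the unitary V implementing conjugation by the
   reflection in x: V is an involution, and comparing operator traces gives
   |tr V| = n - 2, so one of (1 - V) / 2 and (1 + V) / 2 has rank one. *)
Lemma reflection_projection x : dot x x = 1 -> exists2 y, dot y y = 1 &
  let T := pseudoreflection (-1) y in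
  forall Z, twist (pseudoreflection (-1) x) Z = T *m Z *m T.
Proof.
move=> xx; pose S := pseudoreflection 'i x.
have ii : 'i * 'i^* = 1 :> C by rewrite -normCK normCi expr1n.
have uS : S \is unitarymx by exact: pseudoreflection_unitary.
have SS : S *m S = pseudoreflection (-1) x by rewrite /S pseudoreflectionM// -expr2 sqrCi.
have RR : pseudoreflection (-1) x *m pseudoreflection (-1) x = 1%:M.
  by rewrite pseudoreflectionM// mulrNN mulr1 pseudoreflection1.
have [c nc [V uV []]] := twist_square uS; rewrite SS mxtrace_pseudoreflection// => HV.
have VV := unitarymxP uV.
have c1 : c = 1.
  have := HV 1%:M; rewrite twist_id; last by rewrite -SS mul_unitarymx.
  rewrite mulmx1 VV => /(congr1 mxtrace); rewrite mxtraceZ mxtrace1 -{1}[n%:R]mul1r.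
  by move/(mulIf nat1) => <-.
rewrite c1 mul1r => trV.
have {}HV Z : twist (pseudoreflection (-1) x) Z = V *m Z *m V^t* by rewrite HV c1 scale1r.
(* Twisting twice by an involution is the identity, so V^2 is central. *)
have [l VVl] : exists l, V *m V = l%:M.
  apply: central_scalar => // Z.
  have : twist (pseudoreflection (-1) x) (twist (pseudoreflection (-1) x) Z) = Z.
    by rewrite twistM RR twist1.
  rewrite !HV => {2}<-; rewrite !mulmxA.
  by rewrite !mulmxKtV.
have ll : l * l^* = 1.
  have := mul_unitarymx uV uV; rewrite VVl => /unitarymxP.
  rewrite adjmx_scalar -scalar_mxM.
  by move=> /matrixP/(_ (Ordinal n_gt0) (Ordinal n_gt0)); rewrite !mxE eqxx.
(* This phase turns V into an involution W without changing the conjugation; a unitary involution is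
   self-adjoint. *)
pose m := (sqrtC l)^-1.
have mm : m * m^* = 1.
  rewrite -normCK /m normfV exprVn -normrX sqrtCK.
  have -> : `|l| = 1 by apply/eqP; rewrite -sqrp_eq1// normCK ll.
  exact: invr1.
have m2 : m * m * l = 1.
  rewrite -expr2 /m exprVn sqrtCK mulVf//; apply/eqP => l0.
  by move/eqP: ll; rewrite l0 mul0r eq_sym oner_eq0.
have [W WE] : exists W, W = m *: V by exists (m *: V).
have WW : W *m W = 1%:M.
  by rewrite WE -scalemxAl -scalemxAr scalerA VVl scale_scalar_mx m2.
have adjW : W^t* = W.
  have uW : W *m W^t* = 1%:M.
    by rewrite WE adjmxZ -scalemxAl -scalemxAr scalerA mm scale1r.
  by rewrite -[LHS]mul1mx -WW -mulmxA uW mulmx1.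
have {}HV Z : twist (pseudoreflection (-1) x) Z = W *m Z *m W.
  rewrite HV -{2}adjW WE adjmxZ -!scalemxAl -!scalemxAr scalerA.
  by rewrite mm scale1r.
have trW : \tr W ^+ 2 = (n%:R - 2) ^+ 2.
  transitivity (\tr W * (\tr W)^*); first by rewrite -mxtrace_adj adjW.
  rewrite WE mxtraceZ rmorphM/= mulrACA mm mul1r trV.
  by rewrite !(rmorphD, rmorphN)/= conjC1 conjC_nat; ring.
(* W is determined up to sign only. The sign giving trace n - 2 makes (1 - s W) / 2 a projection of
   trace (n - (n - 2)) / 2 = 1. *)
have [s ss [sR trsW]] : exists2 s : C, s * s = 1 & s^* = s /\ \tr (s *: W) = n%:R - 2.
  move/eqP: trW; rewrite eqf_sqr => /orP[] /eqP trW.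
    by exists 1; rewrite ?mulr1// conjC1 scale1r.
  exists (-1); first by rewrite mulrNN mulr1.
  by rewrite rmorphN/= conjC1 mxtraceZ trW mulN1r opprK.
pose A := 2^-1 *: (1%:M - s *: W).
have AA : A *m A = A.
  rewrite /A -!scalemxAl -!scalemxAr mulmxBl !mulmxBr !mul1mx mulmx1.
  rewrite -!scalemxAl -!scalemxAr WW [s *: (s *: _)]scalerA ss scale1r.
  by move: (W) => X; apply/matrixP => i j; rewrite !mxE; field.
have adjA : A^t* = A.
  by rewrite /A adjmxZ adjmxB adjmx1 adjmxZ sR adjW fmorphV/= conjC_nat.
have trA : \tr A = 1.
  by rewrite /A mxtraceZ mxtraceD raddfN/= trsW mxtrace1; field.
have [y yy Ay] := trace_one_projection AA adjA trA; exists y => //= Z.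
have -> : pseudoreflection (-1) y = s *: W.
  rewrite /pseudoreflection -Ay /A; move: (W) => X.
  by apply/matrixP => i j; rewrite !mxE; field.
by rewrite HV -!scalemxAl -scalemxAr scalerA ss scale1r.
Qed.

(** Commuting with conjugation by the reflection T only determines the image of T up to sign: it
    induces the same conjugation as T and is an involution, hence is T or -T. Twisting a second time
    removes the sign, which is why S occurs squared. *)
Lemma twist_square_fix S y : S \is unitarymx -> dot y y = 1 ->
  (forall Z, twist S (pseudoreflection (-1) y *m Z *m pseudoreflection (-1) y) =
     pseudoreflection (-1) y *m twist S Z *m pseudoreflection (-1) y) ->
  twist (S *m S) (y *m y^t*) = y *m y^t*.
Proof.
move=> uS yy; set T := pseudoreflection (-1) y => HT.
have TT : T *m T = 1%:M.
  by rewrite /T pseudoreflectionM// mulrNN mulr1 pseudoreflection1.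
pose J := twist S T.
have JJ : J *m J = 1%:M.
  by rewrite -{1}[J]mulmx1 -(twist_id uS) -(twist_triple _ _ uS) mulmx1 TT.
have JZ Z : J *m Z *m J = T *m Z *m T.
  by rewrite -(twistVK uS Z) -(twist_triple _ _ uS) HT.
have [k kE] : exists k, T *m J = k%:M.
  apply: central_scalar => // Z.
  have /(congr1 (fun X => T *m X *m J)) := JZ Z.
  rewrite !mulmxA TT mul1mx -[_ *m J *m J]mulmxA JJ mulmx1.
  by rewrite -!mulmxA.
have JE : J = k *: T by rewrite -mul_mx_scalar -kE mulmxA TT mul1mx.
have kk : k * k = 1.
  have := JJ; rewrite JE -scalemxAl -scalemxAr scalerA TT => /(congr1 mxtrace).
  by rewrite mxtraceZ -[RHS]mul1r mxtrace1 => /(mulIf nat1).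
have TE : twist (S *m S) T = T.
  by rewrite -twistM -/J JE linearZ/= -/J JE scalerA kk scale1r.
have uSS : S *m S \is unitarymx by rewrite mul_unitarymx.
move: TE; rewrite /T /pseudoreflection linearD linearZ/= twist_id// => /addrI /scalerI -> //.
by rewrite -opprD oppr_eq0 -mulr2n pnatr_eq0.
Qed.


(** A is block diagonal for the line of x and its complement, and on the complement it commutes with
    every operator. *)
Lemma comm_ortho_outer x A : dot x x = 1 ->
  A *m (x *m x^t*) = x *m x^t* *m A ->
  (forall y, dot y y = 1 -> dot x y = 0 -> A *m (y *m y^t*) = y *m y^t* *m A) ->
  exists a b, A = a *: (x *m x^t*) + b%:M.
Proof.
move=> xx Ax Ay; set p := x *m x^t* in Ax *.
have [p' p'E] : exists p', p' = 1%:M - p by exists (1%:M - p).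
have pp : p *m p = p by rewrite /p outerM xx scale1r.
have adjp' : p'^t* = p' by rewrite p'E adjmxB adjmx1 outer_adj.
have xp' z : dot x (p' *m z) = 0.
  by rewrite p'E mulmxBl mul1mx outerMv dotDr -scaleNr dotZr xx mulr1 subrr.
have Ap' X : A *m (p' *m X *m p') = p' *m X *m p' *m A.
  apply/eqP; rewrite -subr_eq0; apply/eqP.
  pose d X := A *m (p' *m X *m p') - p' *m X *m p' *m A.
  have lin_d : linear d.
    move=> a Y Z; rewrite /d mulmxDr -scalemxAr mulmxDl -scalemxAl.
    rewrite mulmxDr -scalemxAr mulmxDl -scalemxAl.
    by rewrite scalerBr addrACA opprD.
  pose dl : {linear 'M[C]_n -> 'M[C]_n} :=
    HB.pack d (GRing.isLinear.Build _ _ _ _ d lin_d).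
  rewrite -[LHS]/(dl X); apply: outer_span => z; rewrite -[LHS]/(d _) /d.
  have -> : p' *m (z *m z^t*) *m p' = (p' *m z) *m (p' *m z)^t*.
    by rewrite adjmxM adjp' !mulmxA.
  have := xp' z; move: (p' *m z) => y xy.
  have [s [u yE /(_ n_gt0) uu]] := unit_scale y.
  have [s0|s0] := eqVneq s 0.
    by rewrite yE s0 scale0r mul0mx mulmx0 mul0mx subrr.
  have xu : dot x u = 0.
    by move/eqP: xy; rewrite yE dotZr mulf_eq0 (negPf s0) => /eqP.
  by rewrite yE adjmxZ -!scalemxAl -!scalemxAr -!scalemxAl Ay// subrr.
(* Here the dimension matters: if the complement of x were 0, then x x^* = 1 and taking traces gives
   n = 1. *)
have [y0 yy xy] : exists2 y, dot y y = 1 & dot x y = 0.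
  have [k xk] : exists k, p' *m delta_mx k 0 != 0 :> 'cV_n.
    apply: contrapT => H; have p'0 : p' = 0.
      apply/matrixP => i j; rewrite mxE.
      have : p' *m delta_mx j 0 = 0 :> 'cV_n.
        by apply/eqP/negPn/negP => pj; apply: H; exists j.
      by rewrite -colE => /matrixP/(_ i 0); rewrite !mxE.
    have /(congr1 mxtrace) : p = 1%:M.
      by apply/eqP; rewrite eq_sym -subr_eq0 -p'E p'0.
    rewrite mxtrace_outer xx mxtrace1 => /esym/eqP; rewrite pnatr_eq1 => /eqP n1.
    by move: n_ge2; rewrite n1.
  have [s [u yE /(_ n_gt0) uu]] := unit_scale (p' *m delta_mx k 0); exists u => //.
  have := xp' (delta_mx k 0); rewrite yE dotZr => /eqP.
  by rewrite mulf_eq0 => /orP[/eqP s0|/eqP//]; rewrite yE s0 scale0r eqxx in xk.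
pose b := dot y0 (A *m y0); pose a := dot x (A *m x).
have Ap : A *m p = a *: p.
  have := congr1 (mulmx^~ p) Ax; rewrite -mulmxA pp => ->.
  by rewrite /p -!mulmxA (mulmxA A) (mulmxA _ (A *m x)) dotE mul_scalar_mx -scalemxAr.
have p'y : p' *m y0 = y0 by rewrite p'E mulmxBl mul1mx outerMv xy scale0r subr0.
(* Commute A with (p' z) [y0]^* and apply both sides to [y0]. *)
have Apb : A *m p' = b *: p'.
  suff H (z : 'cV_n) : A *m p' *m z = b *: p' *m z.
    by apply/matrixP => i j; have /matrixP/(_ i 0) := H (delta_mx j 0); rewrite -!colE !mxE.
  have := congr1 (mulmx^~ y0) (Ap' (z *m y0^t*)).
  have -> : p' *m (z *m y0^t*) *m p' = (p' *m z) *m y0^t*.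
    by rewrite -{2}p'y adjmxM adjp' !mulmxA.
  rewrite -[LHS]mulmxA outerMv yy scale1r mulmxA => ->.
  by rewrite -[LHS]mulmxA outerMv -/b scalemxAl.
exists (a - b), b.
have -> : A = A *m p + A *m p' by rewrite -mulmxDr p'E addrC subrK mulmx1.
by rewrite Ap Apb p'E scalerBr scalerBl scalemx1 addrCA addrC addrAC -addrA addrCA.
Qed.

(** One pair suffices: the relation between y y^* and phi(x x^* ) for a single x spreads to all unit
    vectors, because twists fix the identity and the unitary group is transitive on rank one
    projections. *)
Lemma rank1_preserving_combination : exists2 a : C, a != 0 & exists b : C,
  rank1_preserving (fun X => a *: phi X + (b * \tr X)%:M).
Proof.
pose x : 'cV[C]_n := delta_mx (Ordinal n_gt0) 0.
have xx : dot x x = 1 by rewrite /dot adjmx_delta mul_delta_mx mxE !eqxx.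
have [y yy Hy] := reflection_projection xx; cbv zeta in Hy.
have N1 : (-1 : C) * (-1)^* = 1 by rewrite rmorphN/= conjC1 mulrNN mulr1.
have ii : 'i * 'i^* = 1 :> C by rewrite -normCK normCi expr1n.
have N11 : -1 != 1 :> C by rewrite eq_sym -addr_eq0 -mulr2n pnatr_eq0.
(* The reflections in x and z commute, and so do the pseudoreflection S in z and the reflection in
   x. Hence the twist of S commutes with conjugation by the reflection in y, and the twist of S^2,
   the reflection in z, fixes y y^*. *)
have comm_psi z : dot z z = 1 -> x *m x^t* *m (z *m z^t*) = z *m z^t* *m (x *m x^t*) ->
    psi (y *m y^t*) *m (z *m z^t*) = z *m z^t* *m psi (y *m y^t*).
  move=> zz xz; pose S := pseudoreflection 'i z.
  have uS : S \is unitarymx by exact: pseudoreflection_unitary.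
  have SS : S *m S = pseudoreflection (-1) z.
    by rewrite /S pseudoreflectionM// -expr2 sqrCi.
  have uR : pseudoreflection (-1) z \is unitarymx by exact: pseudoreflection_unitary.
  apply: (comm_pseudoreflection N11); apply: unitary_comm => //.
  suff : twist (S *m S) (y *m y^t*) = y *m y^t*.
    by rewrite SS /twist => /(congr1 psi); rewrite phiK.
  apply: twist_square_fix => // Z; rewrite -!Hy !twistM; congr (twist _ Z).
  apply/esym/pseudoreflection_comm/esym/pseudoreflection_comm.
  by rewrite xz.
have [a [b abE]] : exists a b, psi (y *m y^t*) = a *: (x *m x^t*) + b%:M.
  apply: comm_ortho_outer => //; first exact: comm_psi.
  move=> z zz xz; apply: comm_psi => //.
  by rewrite !outerM xz dotC xz rmorph0 !scale0r.
have [g g0 p1] := psi1_scalar.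
have phi_scalar c : phi c%:M = (c / g)%:M.
  transitivity (phi ((c / g) *: psi 1%:M)).
    by rewrite p1 scale_scalar_mx divfK.
  by rewrite linearZ/= psiK scalemx1.
have yE : y *m y^t* = a *: phi (x *m x^t*) + (b / g)%:M.
  by rewrite -(psiK (y *m y^t*)) abE linearD linearZ/= phi_scalar.
(* Otherwise the rank one projection y y^* would be scalar, impossible in dimension at least 2. *)
have a0 : a != 0.
  apply/eqP => a0; move: yE; rewrite a0 scale0r add0r; set c := b / g => yc.
  have trc : c * n%:R = 1.
    by rewrite mulr_natr -mxtrace_scalar -yc mxtrace_outer.
  have c0 : c != 0 by apply/eqP => c0; move/eqP: trc; rewrite c0 mul0r eq_sym oner_eq0.
  have : c *: (y *m y^t*) = c *: 1%:M.
    by rewrite -mul_scalar_mx -yc outerM yy scale1r yc scalemx1.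
  move=> /(scalerI c0) /(congr1 mxtrace); rewrite mxtrace_outer yy mxtrace1.
  by move/esym/eqP; rewrite pnatr_eq1 => /eqP n1; move: n_ge2; rewrite n1.
exists a => //; exists (b / g).
pose th X := a *: phi X + (b / g * \tr X)%:M.
have lin_th : linear th.
  move=> k X Y; rewrite /th linearP mxtraceD mxtraceZ mulrDr.
  move: (phi X) (phi Y) => X' Y'.
  by apply/matrixP => i j; rewrite !mxE; case: (i == j); rewrite ?mulr1n ?mulr0n; ring.
pose Th : {linear 'M[C]_n -> 'M[C]_n} :=
  HB.pack th (GRing.isLinear.Build _ _ _ _ th lin_th).
have th1 z : dot z z = 1 -> exists2 w, dot w w = 1 & th (z *m z^t*) = w *m w^t*.
  move=> zz; have [U uU UE] := unitary_transitive xx zz.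
  have -> : th (z *m z^t*) = twist U (y *m y^t*).
    rewrite /th mxtrace_outer zz mulr1 yE linearD linearZ/=.
    rewrite -[(b / g)%:M in RHS]scalemx1 linearZ/= twist_id// scalemx1.
    by rewrite /twist phiK UE.
  have [V uV [] ->] := twist_form uU.
    exists (V *m y); last by rewrite adjmxM !mulmxA.
    rewrite /dot adjmxM -mulmxA (mulmxA _ V).
    have := uV; rewrite -trmxC_unitary => /unitarymxP; rewrite trmxCK => ->.
    by rewrite mul1mx.
  exists (V *m map_mx Num.conj y); last by rewrite tr_outer adjmxM !mulmxA.
  rewrite /dot adjmxM -mulmxA (mulmxA _ V).
  have := uV; rewrite -trmxC_unitary => /unitarymxP; rewrite trmxCK => ->.
  rewrite mul1mx -/(dot _ _) -[RHS](conjC1 C) -yy !dotEsum rmorph_sum.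
  by apply: eq_bigr => i _; rewrite rmorphM/= !mxE.
have trth X : \tr (th X) = \tr X.
  apply/eqP; rewrite -subr_eq0; apply/eqP.
  pose d X : C^o := \tr (th X) - \tr X.
  have lin_d : linear d.
    move=> k Y Z; rewrite /d lin_th (mxtraceD (k *: th Y)) (mxtraceD (k *: Y)) !mxtraceZ.
    by rewrite -[k *: _]/(k * _); ring.
  pose dl : {linear 'M[C]_n -> C^o} :=
    HB.pack d (GRing.isLinear.Build _ _ _ _ d lin_d).
  suff d0 (z : 'cV_n) : dl (z *m z^t*) = 0 by exact: (outer_span d0 X).
  have [s [u -> /(_ n_gt0) uu]] := unit_scale z.
  rewrite adjmxZ -scalemxAl -scalemxAr !linearZ/= -/(d _) /d.
  have [w ww ->] := th1 u uu.
  by rewrite !mxtrace_outer ww uu subrr !scaler0.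
split=> //.
(* Preservation of the trace kills the scalar term on the kernel, so injectivity reduces to that of
   [phi]. *)
- suff ker X : Th X = 0 -> X = 0.
    move=> X Y XY; apply/eqP; rewrite -subr_eq0; apply/eqP/ker.
    by rewrite linearB; apply/eqP; rewrite subr_eq0; apply/eqP.
  rewrite -[Th X]/(th X) => X0; have trX : \tr X = 0 by rewrite -trth X0 mxtrace0.
  move: X0; rewrite /th trX mulr0 raddf0 addr0 => /eqP.
  rewrite scaler_eq0 (negPf a0) => /eqP X0.
  by rewrite -(phiK X) X0 linear0.
- move=> z; have [s [u -> /(_ n_gt0) uu]] := unit_scale z.
  have [w ww Ew] := th1 u uu; exists (s *: w).
  rewrite !adjmxZ -!scalemxAl -!scalemxAr -/(th _) -[th _]/(Th _) !linearZ/=.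
  by rewrite -/(th _) Ew !scalerA [s * _]mulrC.
Qed.

Theorem qform_preserver_form :
  exists V (c a : C), [/\ V \is unitarymx, c != 0 &
    (forall X, phi X = c *: (V *m X *m V^t*) + (a * \tr X)%:M) \/
    (forall X, phi X = c *: (V *m X^T *m V^t*) + (a * \tr X)%:M)].
Proof.
have [a a0 [b rp]] := rank1_preserving_combination.
pose th X := a *: phi X + (b * \tr X)%:M.
have lin_th : linear th.
  move=> k X Y; rewrite /th linearP mxtraceD mxtraceZ mulrDr.
  move: (phi X) (phi Y) => X' Y'.
  by apply/matrixP => i j; rewrite !mxE; case: (i == j); rewrite ?mulr1n ?mulr0n; ring.
pose Th : {linear 'M[C]_n -> 'M[C]_n} :=
  HB.pack th (GRing.isLinear.Build _ _ _ _ th lin_th).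
have phiE X : phi X = a^-1 *: th X + (- (b / a) * \tr X)%:M.
  rewrite /th scalerDr scalerA mulVf// scale1r scale_scalar_mx -addrA -raddfD/=.
  rewrite (_ : a^-1 * _ + _ = 0) ?raddf0 ?addr0//; ring.
have [V uV HV] := @rank1_preservingP _ _ Th n_gt0 rp.
exists V, a^-1, (- (b / a)); split=> //; first by rewrite invr_eq0.
by case: HV => HV; [left|right] => X; rewrite phiE -[th X]/(Th X) HV.
Qed.

End MatrixTheorem.

(** * Attainment of the numerical radius *)

Section ComplexContinuity.
Local Open Scope classical_set_scope.
Context {R : realType} {T : topologicalType}.
Implicit Types (f g : T -> R[i]).

(** Continuity is split into real components because the extreme value theorem is applied to a real
    function. *)
Definition ccontinuous f :=
  continuous (fun t => complex.Re (f t)) /\ continuous (fun t => complex.Im (f t)).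

Lemma ccontinuous_cst c : ccontinuous (fun=> c).
Proof. by split; exact: cst_continuous. Qed.

Lemma ccontinuousD f g :
  ccontinuous f -> ccontinuous g -> ccontinuous (fun t => f t + g t).
Proof.
move=> [f1 f2] [g1 g2]; split.
  rewrite (_ : (fun t => _) = (fun t => complex.Re (f t) + complex.Re (g t))).
    by move=> t; apply: cvgD; [exact: f1|exact: g1].
  by apply/funext => t; case: (f t) (g t) => [a b] [c d].
rewrite (_ : (fun t => _) = (fun t => complex.Im (f t) + complex.Im (g t))).
  by move=> t; apply: cvgD; [exact: f2|exact: g2].
by apply/funext => t; case: (f t) (g t) => [a b] [c d].
Qed.

Lemma ccontinuousM f g :
  ccontinuous f -> ccontinuous g -> ccontinuous (fun t => f t * g t).
Proof.
move=> [f1 f2] [g1 g2]; split.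
  rewrite (_ : (fun t => _) = (fun t => complex.Re (f t) * complex.Re (g t)
                                   - complex.Im (f t) * complex.Im (g t))).
    move=> t; apply: cvgB; apply: cvgM;
      by [exact: f1|exact: g1|exact: f2|exact: g2].
  by apply/funext => t; case: (f t) (g t) => [a b] [c d].
rewrite (_ : (fun t => _) = (fun t => complex.Re (f t) * complex.Im (g t)
                                 + complex.Im (f t) * complex.Re (g t))).
  move=> t; apply: cvgD; apply: cvgM;
    by [exact: f1|exact: g1|exact: f2|exact: g2].
by apply/funext => t; case: (f t) (g t) => [a b] [c d].
Qed.

Lemma ccontinuousJ f : ccontinuous f -> ccontinuous (fun t => (f t)^*).
Proof.
move=> [f1 f2]; split.
  rewrite (_ : (fun t => _) = (fun t => complex.Re (f t)))//.
  by apply/funext => t; case: (f t).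
rewrite (_ : (fun t => _) = (fun t => - complex.Im (f t))).
  by move=> t; apply: cvgN; exact: f2.
by apply/funext => t; case: (f t).
Qed.

Lemma ccontinuous_sum (I : finType) (F : I -> T -> R[i]) :
  (forall i, ccontinuous (F i)) -> ccontinuous (fun t => \sum_i F i t).
Proof.
move=> cF; suff H (r : seq I) : ccontinuous (fun t => \sum_(i <- r) F i t) by exact: H.
elim: r => [|i r IH].
  rewrite (_ : (fun t => _) = (fun=> 0)); first exact: ccontinuous_cst.
  by apply/funext => t; rewrite big_nil.
rewrite (_ : (fun t => _) = (fun t => F i t + \sum_(i <- r) F i t)).
  exact: ccontinuousD.
by apply/funext => t; rewrite big_cons.
Qed.

End ComplexContinuity.

Lemma norm_le_Re (R : realType) (a b : R[i]) :
  complex.Re (a * a^*) <= complex.Re (b * b^*) -> `|a| <= `|b|.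
Proof.
rewrite -lecR !RRe_real ?ger0_real ?mul_conjC_ge0// -!normCK.
by rewrite ler_pXn2r// nnegrE normr_ge0.
Qed.

Section Attained.
Local Open Scope classical_set_scope.
Local Open Scope sesquilinear_scope.
Context {R : realType} {n : nat}.
Hypothesis n_gt0 : (0 < n)%N.

(** Real coordinates on the complex vectors, real parts first, so that compactness of the sphere is
    Heine-Borel. *)
Let cvec (u : 'rV[R]_(n + n)) : 'cV[R[i]]_n :=
  \col_i (u 0 (lshift n i) +i* u 0 (rshift n i))%C.

Let cvec_surj (x : 'cV[R[i]]_n) : exists u, cvec u = x.
Proof.
exists (row_mx (\row_i complex.Re (x i 0)) (\row_i complex.Im (x i 0))).
apply/matrixP => i j; rewrite (ord1 j) mxE row_mxEl row_mxEr !mxE.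
by case: (x i 0).
Qed.

Let cvec_coord i : ccontinuous (fun u => cvec u i 0).
Proof.
split.
  rewrite (_ : (fun u => _) = (fun u : 'rV[R]_(n + n) => u 0 (lshift n i))).
    exact: coord_continuous.
  by apply/funext => u; rewrite mxE.
rewrite (_ : (fun u => _) = (fun u : 'rV[R]_(n + n) => u 0 (rshift n i))).
  exact: coord_continuous.
by apply/funext => u; rewrite mxE.
Qed.

Let qform_ccontinuous (A : 'M[R[i]]_n) : ccontinuous (fun u => qform A (cvec u)).
Proof.
rewrite (_ : (fun u => _) = (fun u =>
    \sum_i (cvec u i 0)^* * \sum_j A i j * cvec u j 0)).
  apply: ccontinuous_sum => i; apply: ccontinuousM; first exact: ccontinuousJ (cvec_coord i).
  by apply: ccontinuous_sum => j; apply: ccontinuousM (ccontinuous_cst _) (cvec_coord j).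
apply/funext => u; rewrite /qform dotEsum; apply: eq_bigr => i _.
by congr (_ * _); rewrite [LHS]mxE.
Qed.

(** The squared modulus of the form is a real continuous function on the compact unit sphere. *)
Lemma qform_attained : @qform_max_attained R[i] n.
Proof.
move=> A; pose S := [set u | complex.Re (qform 1%:M (cvec u)) = 1].
have SE u : S u <-> dot (cvec u) (cvec u) = 1.
  rewrite /S /= /qform mul1mx; have := ger0_real (dot_ge0 (cvec u)).
  move=> /RRe_real; set d := dot _ _ => H; split=> [d1|->//].
  by rewrite -H d1.
have normS u k : S u -> `|u 0 k| <= 1.
  move=> /SE uu; have v1 i : `|cvec u i 0| <= 1.
    by apply: (le_trans (coord_le_vnorm _ _)); rewrite /vnorm uu sqrtC1.
  case: (splitP k) => i ki.
    have -> : k = lshift n i by exact: val_inj.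
    have := le_trans (normc_ge_Re _) (v1 i); rewrite mxE /= -[1]/(1%:C)%C lecR.
    by [].
  have -> : k = rshift n i by exact: val_inj.
  (* Multiplication by -i turns the imaginary part into a real part without changing the modulus. *)
  have := le_trans (normc_ge_Re (- 'i%C * cvec u i 0)) (_ : _ <= 1).
  rewrite normrM normrN (_ : `|'i%C| = 1 :> R[i]); last first.
    by rewrite normc_def /= expr0n add0r expr1n sqrtr1.
  move=> /(_ _); rewrite mul1r => /(_ (v1 i)).
  rewrite (_ : complex.Re _ = u 0 (rshift n i)); last first.
    by rewrite mxE; simpc; rewrite /=; ring.
  by rewrite -[1]/(1%:C)%C lecR.
have cS : compact S.
  apply: bounded_closed_compact.
    exists 1; split; first exact: real1.
    move=> M M1 u Su; apply: le_trans (ltW M1).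
    rewrite [leLHS]/Num.norm /= mx_normrE; apply: bigmax_le => // -[i k] _ /=.
    by rewrite (ord1 i); exact: normS.
  rewrite (_ : S = (fun u => complex.Re (qform 1%:M (cvec u))) @^-1` [set x | x = 1])//.
  apply: preimage_closed; last exact: closed_eq.
  by move=> u _; exact: (qform_ccontinuous _).1.
have S0 : S !=set0.
  have [u uE] := cvec_surj (delta_mx (Ordinal n_gt0) 0); exists u.
  by apply/SE; rewrite uE /dot adjmx_delta mul_delta_mx mxE !eqxx.
pose f u := complex.Re (qform A (cvec u) * (qform A (cvec u))^*).
have cf : continuous f.
  exact: (ccontinuousM (qform_ccontinuous A) (ccontinuousJ (qform_ccontinuous A))).1.
have [u uS umax] := compact_EVT_max S0 cS (continuous_subspaceT cf).
exists (cvec u); first by apply/SE; move: uS; rewrite inE.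
move=> x; have [v <-] := cvec_surj x => /SE vS.
by apply/norm_le_Re/umax; rewrite inE.
Qed.

End Attained.

(** * From operators to matrices *)

Section UnitarySimilarity.
Local Open Scope sesquilinear_scope.
Context {C : numClosedFieldType} {n : nat}.
Implicit Types (A B U V : 'M[C]_n).

Lemma unitarymx_adjM U : U \is unitarymx -> U^t* *m U = 1%:M.
Proof. by rewrite -trmxC_unitary => /unitarymxP; rewrite trmxCK. Qed.

Definition unitary_equiv A B := exists2 U, U \is unitarymx & A = U *m B *m U^t*.

Lemma unitary_equiv_trace A B : unitary_equiv A B -> \tr A = \tr B.
Proof.
by move=> [U uU ->]; rewrite mxtrace_mulC mulmxA unitarymx_adjM// mul1mx.
Qed.

Lemma unitary_equiv_tr A B : unitary_equiv A B -> unitary_equiv A^T B^T.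
Proof.
move=> [U uU ->]; exists (map_mx Num.conj U); first by rewrite conjC_unitary.
rewrite !trmx_mul mulmxA; congr (_ *m _ *m _); first by rewrite map_trmx trmxK.
by apply/matrixP => i j; rewrite !mxE conjCK.
Qed.

Lemma unitary_equiv_affine V A B (c t : C) :
  V \is unitarymx -> unitary_equiv A B ->
  unitary_equiv (c *: (V *m A *m V^t*) + t *: 1%:M)
                (c *: (V *m B *m V^t*) + t *: 1%:M).
Proof.
(* The conjugating unitary is itself conjugated by V; the scalar term is unaffected. *)
move=> uV [U uU ->]; exists (V *m U *m V^t*).
  by rewrite !mul_unitarymx// trmxC_unitary.
have V'V := unitarymx_adjM uV.
rewrite mulmxDr mulmxDl -!scalemxAr -!scalemxAl; congr (_ + _).
  rewrite !adjmxM trmxCK !mulmxA -(mulmxA _ (V^t*) V) V'V mulmx1.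
  by rewrite -(mulmxA _ (V^t*) V) V'V mulmx1.
rewrite mulmx1; congr (_ *: _); apply/esym/unitarymxP.
by rewrite !mul_unitarymx// trmxC_unitary.
Qed.

End UnitarySimilarity.

(** * Operators in coordinates of an orthonormal basis *)

Section Transfer.
Local Open Scope sesquilinear_scope.
Context {R : realType} {H : vectType R[i]} (dotp : {dot H for Num.conj}).
Variables (e : (\dim {:H}).-tuple H) (he : orthonormal_basis dotp e).
Implicit Types (T S W X : 'End(H)) (x y : H).

Let be : basis_of {:H} e. Proof. by case/andP: he. Qed.

(* [mxof] acts on row vectors, hence the transposition. *)
Definition opmx X : 'M[R[i]]_(\dim {:H}) := (mxof e e X)^T.
Definition mxop (A : 'M[R[i]]_(\dim {:H})) : 'End(H) := hommx e e A^T.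
Definition vcol x : 'cV[R[i]]_(\dim {:H}) := (rVof e x)^T.

Lemma opmxK : cancel opmx mxop.
Proof. by move=> X; rewrite /mxop /opmx trmxK (mxofK be be). Qed.

Lemma mxopK : cancel mxop opmx.
Proof. by move=> A; rewrite /mxop /opmx (hommxK be be) trmxK. Qed.

Lemma opmx_linear : linear opmx.
Proof. by move=> a X Y; rewrite /opmx !linearP. Qed.

Lemma mxop_linear : linear mxop.
Proof. by move=> a A B; rewrite /mxop !linearP. Qed.

Lemma opmx_comp X Y : opmx (X \o Y)%VF = opmx X *m opmx Y.
Proof. by rewrite /opmx (mxof_comp _ _ be) trmx_mul. Qed.

Lemma opmx1 : opmx \1%VF = 1%:M.
Proof. by rewrite /opmx mxof1 ?(basis_free be)// trmx1. Qed.

Lemma opmxE X i j : opmx X i j = dotp (X (tnth e j)) (tnth e i).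
Proof. by rewrite mxE (mxof_basisE he). Qed.

Lemma opmx_adj X : opmx (adjoint dotp X) = (opmx X)^t*.
Proof.
apply/matrixP => i j; rewrite opmxE mxE mxE opmxE dotpC.
by rewrite -(adjointP he).
Qed.

Lemma vcol_surj (v : 'cV[R[i]]_(\dim {:H})) : exists x, vcol x = v.
Proof. by exists (vecof e v^T); rewrite /vcol (vecofK be) trmxK. Qed.

Lemma vcol_app X x : vcol (X x) = opmx X *m vcol x.
Proof. by rewrite /vcol (rVof_app e be) trmx_mul. Qed.

(** The arguments swap because [dotp] is linear in its first argument while [dot] is linear in its
    second. *)
Lemma dotp_vcol x y : dotp x y = dot (vcol y) (vcol x).
Proof.
rewrite [x in LHS](basis_expand he) dotp_suml dotEsum.
apply: eq_bigr => i _; rewrite !mxE !(coord_dotp he) mulrC.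
by rewrite [dotp (tnth e i) y]dotpC.
Qed.

Lemma qform_vcol T x : dotp (T x) x = qform (opmx T) (vcol x).
Proof. by rewrite dotp_vcol vcol_app. Qed.

Lemma unitary_opmx W : unitary dotp W <-> opmx W \is unitarymx.
Proof.
split=> [[W1 _]|uW].
  by apply/unitarymxP; rewrite -opmx_adj -opmx_comp W1 opmx1.
split; apply: (can_inj opmxK); rewrite opmx_comp opmx_adj opmx1.
  exact/unitarymxP.
have := uW; rewrite -trmxC_unitary => /unitarymxP.
by rewrite trmxCK.
Qed.

Lemma lftrace_opmx X : lftrace X = \tr (opmx X).
Proof. by rewrite (lftraceE he); apply: eq_bigr => i _; rewrite opmxE. Qed.

Lemma opmx_tr X : opmx (lftranspose e X) = (opmx X)^T.
Proof. by rewrite /opmx /lftranspose (hommxK be be) trmxK. Qed.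

Lemma hnorm1 x : hnorm dotp x = 1 <-> dot (vcol x) (vcol x) = 1.
Proof.
rewrite /hnorm dotp_vcol; set d := dot _ _.
have d0 : 0 <= d by exact: dot_ge0.
have dE := RRe_real (ger0_real d0).
have r0 : 0 <= complex.Re d by rewrite -lecR dE.
split=> [|->]; last by rewrite sqrtr1.
move=> /(congr1 (fun r => r ^+ 2)); rewrite sqr_sqrtr// expr1n => d1.
by rewrite -dE d1.
Qed.

Lemma normc_norm (z : R[i]) : (Normc.normc z)%:C%C = `|z|.
Proof. by []. Qed.

(** The supremum is a maximum, which turns equality of numerical radii into the pointwise comparison
    [qform_le]. *)
Lemma numradius_attained T : (0 < \dim {:H})%N -> exists y,
  [/\ hnorm dotp y = 1, numradius dotp T = Normc.normc (dotp (T y) y) &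
      forall x, hnorm dotp x = 1 ->
        Normc.normc (dotp (T x) x) <= numradius dotp T].
Proof.
move=> n0; have [v vv vmax] := qform_attained n0 (opmx T).
have [y yv] := vcol_surj v; exists y.
have y1 : hnorm dotp y = 1 by apply/hnorm1; rewrite yv.
have ymax x : hnorm dotp x = 1 ->
    Normc.normc (dotp (T x) x) <= Normc.normc (dotp (T y) y).
  by move/hnorm1 => xx; rewrite -lecR !normc_norm !qform_vcol yv vmax.
suff nE : numradius dotp T = Normc.normc (dotp (T y) y).
  by split=> // x x1; rewrite nE ymax.
apply/eqP; rewrite eq_le; apply/andP; split.
  apply: ge_sup; first by exists (Normc.normc (dotp (T y) y)), y.
  by move=> _ [x x1 <-]; exact: ymax.
apply: ub_le_sup; last by exists y.
by exists (Normc.normc (dotp (T y) y)) => _ [x x1 <-]; exact: ymax.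
Qed.

Lemma numradius_qform_le T S : (0 < \dim {:H})%N ->
  numradius dotp T = numradius dotp S -> qform_le (opmx T) (opmx S).
Proof.
move=> n0 TS v vv; have [x xv] := vcol_surj v.
have [y [y1 Sy _]] := numradius_attained S n0.
have [_ [_ _ Tle]] := numradius_attained T n0.
exists (vcol y); first exact/hnorm1.
rewrite -xv -!qform_vcol -!normc_norm lecR -Sy -TS Tle//.
by apply/hnorm1; rewrite xv.
Qed.

Lemma numradius_similar T S :
  unitarily_similar dotp T S -> numradius dotp T = numradius dotp S.
Proof.
case=> W [WW W'W] ->; have adjW := adjointP he W.
have hW x : hnorm dotp (adjoint dotp W x) = hnorm dotp x.
  by rewrite /hnorm -adjW -comp_lfunE WW id_lfunE.
congr sup; apply/seteqP; split=> _ [x x1 <-].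
  exists (adjoint dotp W x); first by rewrite /= hW.
  by rewrite !comp_lfunE adjW.
exists (W x).
  by rewrite /= -hW -comp_lfunE W'W id_lfunE.
by rewrite !comp_lfunE adjW -!(comp_lfunE (adjoint dotp W)) W'W !id_lfunE.
Qed.

Lemma unitarily_similar_opmx T S :
  unitarily_similar dotp T S <-> unitary_equiv (opmx T) (opmx S).
Proof.
split=> [[W /unitary_opmx uW ->]|[U uU TE]].
  by exists (opmx W); rewrite // !opmx_comp opmx_adj.
have uW : unitary dotp (mxop U) by apply/unitary_opmx; rewrite mxopK.
exists (mxop U) => //; apply: (can_inj opmxK).
by rewrite !opmx_comp opmx_adj mxopK.
Qed.

Lemma opmx_affine W Y c t : opmx (c *: (W \o Y \o adjoint dotp W)%VF + t *: \1%VF) =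
  c *: (opmx W *m opmx Y *m (opmx W)^t*) + t *: 1%:M.
Proof.
have -> : t *: 1%:M = opmx (t *: \1%VF) by rewrite -opmx1 /opmx !linearZ.
by rewrite opmx_linear (opmx_comp _ (adjoint dotp W)) (opmx_comp W) opmx_adj.
Qed.

Lemma preserver_similar (Phi : {linear 'End(H) -> 'End(H)}) W c alpha :
  unitary dotp W ->
  (forall X, Phi X = c *: (W \o X \o adjoint dotp W)%VF
                     + (alpha * lftrace X) *: \1%VF) \/
  (forall X, Phi X = c *: (W \o lftranspose e X \o adjoint dotp W)%VF
                     + (alpha * lftrace X) *: \1%VF) ->
  forall T S, unitarily_similar dotp T S -> unitarily_similar dotp (Phi T) (Phi S).
Proof.
move=> /unitary_opmx uW HPhi T S /unitarily_similar_opmx TS.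
apply/unitarily_similar_opmx.
have trE : lftrace T = lftrace S.
  by rewrite (lftrace_opmx T) (lftrace_opmx S); exact: unitary_equiv_trace.
have aff Y Z t : unitary_equiv (opmx Y) (opmx Z) ->
    unitary_equiv (opmx (c *: (W \o Y \o adjoint dotp W)%VF + t *: \1%VF))
                  (opmx (c *: (W \o Z \o adjoint dotp W)%VF + t *: \1%VF)).
  by rewrite (opmx_affine W Y) (opmx_affine W Z); exact: unitary_equiv_affine.
have sub Y Z Y' Z' : Y = Y' -> Z = Z' ->
    unitary_equiv (opmx Y') (opmx Z') -> unitary_equiv (opmx Y) (opmx Z).
  by move=> -> ->.
case: HPhi => HPhi; apply: (sub _ _ _ _ (HPhi T) (HPhi S)); rewrite trE; apply: aff.
  exact: TS.
by rewrite (congr2 unitary_equiv (opmx_tr T) (opmx_tr S)); exact: unitary_equiv_tr.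
Qed.

Lemma numradius_preserver_form (Phi : {linear 'End(H) -> 'End(H)}) :
  (1 < \dim {:H})%N -> bijective Phi ->
  (forall T S, unitarily_similar dotp T S ->
     numradius dotp (Phi T) = numradius dotp (Phi S)) ->
  exists (W : 'End(H)) (c alpha : R[i]),
    [/\ unitary dotp W, c != 0 &
      (forall X, Phi X = c *: (W \o X \o adjoint dotp W)%VF
                   + (alpha * lftrace X) *: \1%VF) \/
      (forall X, Phi X = c *: (W \o lftranspose e X \o adjoint dotp W)%VF
                   + (alpha * lftrace X) *: \1%VF)].
Proof.
move=> n2 [Psi PhiK PsiK] HPhi; have n0 : (0 < \dim {:H})%N := ltnW n2.
have lin_Psi : linear Psi by exact: can2_linear PhiK PsiK.
pose phi A := opmx (Phi (mxop A)); pose psi A := opmx (Psi (mxop A)).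
have lin_phi : linear phi.
  by move=> a A B; rewrite /phi mxop_linear linearP opmx_linear.
have lin_psi : linear psi.
  by move=> a A B; rewrite /psi mxop_linear lin_Psi opmx_linear.
pose phil : {linear 'M[R[i]]_(\dim {:H}) -> 'M[R[i]]_(\dim {:H})} :=
  HB.pack phi (GRing.isLinear.Build _ _ _ _ phi lin_phi).
pose psil : {linear 'M[R[i]]_(\dim {:H}) -> 'M[R[i]]_(\dim {:H})} :=
  HB.pack psi (GRing.isLinear.Build _ _ _ _ psi lin_psi).
have phiK : cancel phil psil.
  by move=> A; rewrite /= /psi /phi opmxK PhiK mxopK.
have psiK : cancel psil phil.
  by move=> A; rewrite /= /psi /phi opmxK PsiK mxopK.
(* The only use of (ii): A and U A U^* are the matrices of unitarily similar operators. *)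
have phi_le (U A : 'M[R[i]]_(\dim {:H})) : U \is unitarymx ->
    qform_le (phil (U *m A *m U^t*)) (phil A).
  move=> uU; have UA : unitarily_similar dotp (mxop (U *m A *m U^t*)) (mxop A).
    apply/unitarily_similar_opmx; exists U => //.
    apply: (etrans (mxopK _)); congr (_ *m _ *m _).
    exact: (esym (mxopK A)).
  exact: (numradius_qform_le n0 (HPhi _ _ UA)).
have [V [c [a [uV c0 HV]]]] :=
  qform_preserver_form n2 (qform_attained n0) phiK psiK phi_le.
have PhiE X : opmx (Phi X) = phil (opmx X) by rewrite /= /phi opmxK.
exists (mxop V), c, a; split=> //; first by apply/unitary_opmx; rewrite mxopK.
case: HV => HV; [left|right] => X; apply: (can_inj opmxK).
  by rewrite (PhiE X) HV (opmx_affine _ X) (mxopK V) (lftrace_opmx X) scalemx1.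
apply: (etrans (PhiE X)); apply: (etrans (HV (opmx X))).
apply: (etrans _ (esym (opmx_affine _ _ _ _))).
have eq_affine (V' P P' : 'M[R[i]]_(\dim {:H})) t t' : V' = V -> P' = P -> t' = t ->
    c *: (V *m P *m V^t*) + (a * t)%:M = c *: (V' *m P' *m V'^t*) + (a * t') *: 1%:M.
  by move=> -> -> ->; rewrite scalemx1.
exact: eq_affine (mxopK V) (opmx_tr X) (lftrace_opmx X).
Qed.

End Transfer.

Theorem theorem2p3 (R : realType) (H : vectType R[i])
    (dotp : {dot H for Num.conj}) (dim_ge2 : (2 <= \dim {:H})%N)
    (e : (\dim {:H}).-tuple H) (e_onb : orthonormal_basis dotp e)
    (Phi : {linear 'End(H) -> 'End(H)}) (Phi_bij : bijective Phi) :
  [<->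
    forall T S : 'End(H),
      unitarily_similar dotp T S -> unitarily_similar dotp (Phi T) (Phi S);
    forall T S : 'End(H),
      unitarily_similar dotp T S ->
      numradius dotp (Phi T) = numradius dotp (Phi S);
    exists (W : 'End(H)) (c alpha : R[i]),
      [/\ unitary dotp W, c != 0 &
        (forall X : 'End(H),
           Phi X = c *: (W \o X \o adjoint dotp W)%VF
                   + (alpha * lftrace X) *: \1%VF)
        \/
        (forall X : 'End(H),
           Phi X = c *: (W \o lftranspose e X \o adjoint dotp W)%VF
                   + (alpha * lftrace X) *: \1%VF)]].
Proof.
tfae.
- by move=> H1 T S /H1 /(numradius_similar e_onb).
- exact: numradius_preserver_form.
- by case=> W [c [a [uW _ HPhi]]]; exact: preserver_similar uW HPhi.
Qed.
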